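(* Let $1<\alpha<2$, $\varepsilon>0$, $\beta>0$, $f$ Lipschitz continuous, $u_0\in L^2(\Omega)$ with $\Omega=[a,b]$, and let $(u_h,p_h,q_h)$ be the solution of the semi-discrete LDG scheme described in the context. Then the scheme is stable in the sense that for every $T>0$, $$\|u_h(\cdot,T)\|_{L^2(\Omega)}\le\|u_0\|_{L^2(\Omega)}.$$
   Context: Setting: the fractional convection–diffusion problem $u_t+f(u)_x=\varepsilon\big(-(-\Delta)^{\alpha/2}\big)u$, $u(\cdot,0)=u_0$, is posed on $\Omega=[a,b]$ with homogeneous Dirichlet data ($u=0$ outside $\Omega$). For $1<\alpha<2$ define on $\Omega$ $$\Delta_{(\alpha-2)/2}p(x)=\frac{1}{2\cos\big((2-\alpha)\pi/2\big)\Gamma(2-\alpha)}\Big(\int_a^x(x-s)^{1-\alpha}p(s)\,ds+\int_x^b(s-x)^{1-\alpha}p(s)\,ds\Big).$$ Mesh: $a=x_{1/2}<\dots<x_{K+1/2}=b$, $I_i=[x_{i-1/2},x_{i+1/2}]$, mesh size $h$; $V_h=\{v:\ v|_{I_i}\in P^k(I_i)\ \forall i\}$ (polynomials of degree $\le k$ on each cell). For piecewise smooth $w$: $w^\pm_{j+1/2}=\lim_{x\to x_{j+1/2}^\pm}w(x)$, $\llbracket w\rrbracket=w^+-w^-$, and $(\cdot,\cdot)_{I_i}$ is the $L^2(I_i)$ inner product. Scheme: find $u_h(\cdot,t),p_h(\cdot,t),q_h(\cdot,t)\in V_h$ such that for every $i$ and all $v,w,z\in P^k(I_i)$: $((u_h)_t,v)_{I_i}+\big[(\hat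 f-\sqrt{\varepsilon}\hat q)v\big]_{x^+_{i-1/2}}^{x^-_{i+1/2}}-(f(u_h)-\sqrt{\varepsilon}q_h,v_x)_{I_i}=0$; $(q_h,w)_{I_i}-(\Delta_{(\alpha-2)/2}p_h,w)_{I_i}=0$; $(p_h,z)_{I_i}-\sqrt{\varepsilon}\big[\hat u z\big]_{x^+_{i-1/2}}^{x^-_{i+1/2}}+\sqrt{\varepsilon}(u_h,z_x)_{I_i}=0$; $(u_h(\cdot,0),v)_{I_i}=(u_0,v)_{I_i}$. Here $[g]_{x^+_{i-1/2}}^{x^-_{i+1/2}}=g(x^-_{i+1/2})-g(x^+_{i-1/2})$. Numerical fluxes: at interior nodes $1\le i\le K-1$, $\hat u_{i+1/2}=(u_h)^-_{i+1/2}$, $\hat q_{i+1/2}=(q_h)^+_{i+1/2}$, $\hat f_{i+1/2}=\hat f\big((u_h)^-_{i+1/2},(u_h)^+_{i+1/2}\big)$, where $\hat f$ is a monotone numerical flux (Lipschitz, consistent $\hat f(s,s)=f(s)$, nondecreasing in its first argument and nonincreasing in its second). At the boundary: $\hat u_{1/2}=0$, $\hat q_{1/2}=(q_h)^+_{1/2}$, $\hat u_{K+1/2}=0$, $\hat q_{K+1/2}=(q_h)^-_{K+1/2}+\frac{\beta}{h}\big(0-(u_h)^-_{K+1/2}\big)$, and $\hat f_{1/2}=\hat f(0,(u_h)^+_{1/2})$, $\hat f_{K+1/2}=\hat f((u_h)^-_{K+1/2},0)$. *)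

(* Defs.v *)
(* R is an abstract realType, integrals are Lebesgue
   integrals (needed: the kernel (x-s)^(1-alpha) is unbounded). *)
From HB Require Import structures.
From mathcomp Require Import all_boot all_order all_algebra.
From mathcomp Require Import all_classical all_reals all_analysis.
Set Implicit Arguments. Unset Strict Implicit. Unset Printing Implicit Defensive.
Import Order.TTheory GRing.Theory Num.Theory.
Import numFieldNormedType.Exports.
Local Open Scope classical_set_scope.
Local Open Scope ring_scope.

Section LDG.
Variable R : realType.

Definition Rint (D : set R) (g : R -> R) : R :=
  \int[@lebesgue_measure R]_(x in D) g x.

Definition Gamma (s : R) : R :=
  Rint `]0, +oo[ (fun t => t `^ (s - 1) * expR (- t)).

Definition frac_op (alpha a b : R) (p : R -> R) (x : R) : R :=
  (2 * cos ((2 - alpha) * pi / 2) * Gamma (2 - alpha))^-1 *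
  (Rint `[a, x] (fun s => (x - s) `^ (1 - alpha) * p s) +
   Rint `[x, b] (fun s => (s - x) `^ (1 - alpha) * p s)).

(* Mesh: nodes x_{1/2} < ... < x_{K+1/2} are node 0 < ... < node K;
   the cell I_{i+1} = [node i, node i.+1] (0-based cell index i < K). *)
Definition mesh_ok (K : nat) (node : nat -> R) (a b : R) : Prop :=
  (0 < K)%N /\ node 0%N = a /\ node K = b /\
  forall i : nat, (i < K)%N -> node i < node i.+1.

Definition meshsize (K : nat) (node : nat -> R) : R :=
  \big[Num.max/0]_(i < K) (node i.+1 - node i).

(* A function of V_h is given cellwise: U i is the polynomial on cell i.
   Its values on Omega (on half-open cells; the node values are irrelevant
   for the integrals below). *)
Definition pw (K : nat) (node : nat -> R) (U : nat -> {poly R}) (x : R) : R :=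
  \sum_(i < K) (if (node i <= x) && (x < node i.+1) then (U i).[x] else 0).

(* Numerical fluxes at node j (= x_{j+1/2} in the paper), 0 <= j <= K. *)
Definition uhat (K : nat) (node : nat -> R) (U : nat -> {poly R}) (j : nat) : R :=
  if (j == 0%N) || (j == K) then 0 else (U j.-1).[node j].

Definition qhat (K : nat) (node : nat -> R) (beta h : R)
    (U Q : nat -> {poly R}) (j : nat) : R :=
  if j == K then (Q j.-1).[node j] + beta / h * (0 - (U j.-1).[node j])
  else (Q j).[node j].

Definition fflux (fh : R -> R -> R) (K : nat) (node : nat -> R)
    (U : nat -> {poly R}) (j : nat) : R :=
  if j == 0%N then fh 0 (U 0%N).[node 0%N]
  else if j == K then fh (U j.-1).[node j] 0
  else fh (U j.-1).[node j] (U j).[node j].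

Definition monotone_flux (f : R -> R) (fh : R -> R -> R) : Prop :=
  (exists L : R, forall x y z w : R,
      `|fh x y - fh z w| <= L * (`|x - z| + `|y - w|)) /\
  (forall s, fh s s = f s) /\
  (forall x z y, x <= z -> fh x y <= fh z y) /\
  (forall x y w, y <= w -> fh x w <= fh x y).

Definition L2_on (a b : R) (u0 : R -> R) : Prop :=
  measurable_fun `[a, b] u0 /\
  (\int[@lebesgue_measure R]_(x in `[a, b]) ((u0 x) ^+ 2)%:E < +oo)%E.

Definition L2norm (a b : R) (g : R -> R) : R :=
  Num.sqrt (Rint `[a, b] (fun x => (g x) ^+ 2)).

Definition dt_cell (U : R -> nat -> {poly R}) (i : nat) (t x : R) : R :=
  derive1 (fun s => (U s i).[x]) t.

(* The semi-discrete LDG scheme with (u_h, p_h, q_h) given cellwise by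
   U t i, P t i, Q t i (polynomials of degree <= k on cell i). *)
Definition LDG_solution (alpha eps beta a b : R) (K k : nat) (node : nat -> R)
    (f : R -> R) (fh : R -> R -> R) (u0 : R -> R)
    (U P Q : R -> nat -> {poly R}) : Prop :=
  let h := meshsize K node in
  let se := Num.sqrt eps in
  (forall t i, (i < K)%N ->
     (size (U t i) <= k.+1)%N /\ (size (P t i) <= k.+1)%N /\
     (size (Q t i) <= k.+1)%N) /\
  (forall i j, (i < K)%N ->
     (forall t, 0 < t -> derivable (fun s => (U s i)`_j) t 1) /\
     ((fun s => (U s i)`_j) s @[s --> 0^'+] --> (U 0 i)`_j)) /\
  (forall t, 0 < t -> forall i, (i < K)%N ->
     let xl := node i in let xr := node i.+1 in
     (forall v : {poly R}, (size v <= k.+1)%N ->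
        Rint `[xl, xr] (fun x => dt_cell U i t x * v.[x])
        + ((fflux fh K node (U t) i.+1 - se * qhat K node beta h (U t) (Q t) i.+1)
             * v.[xr]
           - (fflux fh K node (U t) i - se * qhat K node beta h (U t) (Q t) i)
             * v.[xl])
        - Rint `[xl, xr] (fun x => (f (U t i).[x] - se * (Q t i).[x])
                                   * (deriv v).[x]) = 0) /\
     (forall w : {poly R}, (size w <= k.+1)%N ->
        Rint `[xl, xr] (fun x => (Q t i).[x] * w.[x])
        - Rint `[xl, xr] (fun x => frac_op alpha a b (pw K node (P t)) x * w.[x])
        = 0) /\
     (forall z : {poly R}, (size z <= k.+1)%N ->
        Rint `[xl, xr] (fun x => (P t i).[x] * z.[x])
        - se * (uhat K node (U t) i.+1 * z.[xr] - uhat K node (U t) i * z.[xl])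
        + se * Rint `[xl, xr] (fun x => (U t i).[x] * (deriv z).[x]) = 0)) /\
  (forall i, (i < K)%N -> forall v : {poly R}, (size v <= k.+1)%N ->
     Rint `[node i, node i.+1] (fun x => (U 0 i).[x] * v.[x])
     = Rint `[node i, node i.+1] (fun x => u0 x * v.[x])).

End LDG.

(* Main.v *)
(* Test the three cell equations with [u_h], [p_h] and [q_h] and sum over the
   cells. The diffusive fluxes telescope to the boundary penalty
   [beta / h * u^2 >= 0]; the convective ones are, node by node,
   [fh u v * (u - v) - F u + F v >= 0] with [F' = f], by the mean value theorem
   and the monotonicity of [fh]. The remaining term is the quadratic form of the
   Riesz kernel [|x - s|^(-g)], [g = alpha - 1], which is nonnegative because the
   kernel is a mixture of products of interval indicators:
     [g (g + 1) * \int\int_(y <= min x s, max x s <= w) (w - y)^(-g - 2) = |x - s|^(-g)],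
   so that by Tonelli the form is an integral of squares. Hence the energy is
   nonincreasing in time, and its initial value is at most [|u0|^2] since the
   initial datum is an L2 projection. *)
From HB Require Import structures.
From mathcomp Require Import all_boot all_order all_algebra.
From mathcomp Require Import all_classical all_reals all_analysis.
From mathcomp Require Import lra ring measurable_realfun.
Require Import Defs.
Set Implicit Arguments. Unset Strict Implicit. Unset Printing Implicit Defensive.
Import Order.TTheory GRing.Theory Num.Theory.
Import numFieldNormedType.Exports.
Local Open Scope classical_set_scope.
Local Open Scope ring_scope.

(** Tonelli wants nonnegative integrands, while [p_h] changes sign. The kernel form [B] is therefore
    first treated in the extended reals on a pair [q], [r] of nonnegative functions, through the
    subtraction-free inequality [B q r + B r q <= B q q + B r r]. For [q], [r] the positive and
    negative parts of [p_h] the four terms are finite, and the inequality becomes [B p_h p_h >= 0].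
    Finiteness rests on [p_h] being bounded with support in [[a, b]] and on [0 < g < 1], which makes
    the singularity integrable. The factor [g (g + 1)] collects the two integrations over the
    endpoints of the indicator interval. The antiderivative [F] is built on a bounded interval []-
    B, B[] only, so at each time [B] is chosen beyond all values of [u_h]. In time, the energy is a
    finite quadratic form in the coefficients of [u_h], with moments of the cells as matrix; no
    derivative is taken under an integral sign. *)

Section power_integrals.
Context {R : realType}.
Notation mu := (@lebesgue_measure R).
Implicit Types a b c d e g x M : R.

Lemma is_derive_powRD d e z : 0 < z + d ->
  is_derive z 1 (fun t => (t + d) `^ e) (e * (z + d) `^ (e - 1)).
Proof.
move=> zd.
have H1 : is_derive z 1 (fun t : R => t + d) 1.
  by apply: is_derive_eq; rewrite addr0.
have := @is_derive1_comp _ (fun y => y `^ e) (fun t : R => t + d) z _ _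
  (is_derive1_powR e zd) H1.
by rewrite mulr1.
Qed.

Lemma is_derive_powRB d e z : 0 < d - z ->
  is_derive z 1 (fun t => (d - t) `^ e) (- (e * (d - z) `^ (e - 1))).
Proof.
move=> zd.
have H1 : is_derive z 1 (fun t : R => d - t) (- 1).
  by have := is_deriveB (is_derive_cst d z 1) (is_derive_id z 1); rewrite sub0r.
have := @is_derive1_comp _ (fun y => y `^ e) (fun t : R => d - t) z _ _
  (is_derive1_powR e zd) H1.
by rewrite mulrN1.
Qed.

Lemma is_derive_continuous (f : R -> R) (z df : R) :
  is_derive z 1 f df -> {for z, continuous f}.
Proof.
by move=> H; apply/differentiable_continuous/derivable1_diffP; exact: ex_derive.
Qed.

Lemma powRD_cvgy d e : 0 < e -> (z + d) `^ (- e) @[z --> +oo] --> (0:R).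
Proof.
move=> e0; apply/cvgr0Pnorm_lt => r r0.
near=> z.
have zd : (r^-1) `^ (e^-1) < z + d.
  by rewrite -ltrBlDr; near: z; apply: nbhs_pinfty_gt; exact: num_real.
rewrite ger0_norm ?powR_ge0// powRN -[ltRHS]invrK ltf_pV2 ?posrE ?invr_gt0//; last first.
  by rewrite powR_gt0// (le_lt_trans _ zd)// powR_ge0.
have : ((r^-1) `^ (e^-1)) `^ e < (z + d) `^ e.
  rewrite gt0_ltr_powR// ?nnegrE ?powR_ge0//.
  by rewrite (le_trans (powR_ge0 _ _) (ltW zd)).
by rewrite -powRrM mulVf ?lt0r_neq0// powRr1// invr_ge0 ltW.
Unshelve. all: by end_near. Qed.

(** The exponent is written [- e - 1] so that the lemma chains with itself: for [e = g + 1] the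
    result is a multiple of a power [- g - 1], again an integrand of this shape, with [e = g]. The
    kernel computation integrates over the two endpoints of an interval in this way. *)
Lemma integral_powRD_y c d e : 0 < e -> 0 < c + d ->
  (\int[mu]_(z in `[c, +oo[) ((z + d) `^ (- e - 1))%:E = ((c + d) `^ (- e) / e)%:E)%E.
Proof.
move=> e0 cd.
have pos z : c <= z -> 0 < z + d by move=> cz; rewrite (lt_le_trans cd)// lerD2r.
have dF z : c <= z -> is_derive z 1 (fun t => - e^-1 * (t + d) `^ (- e)) ((z + d) `^ (- e - 1)).
  move=> cz; have := is_deriveZ (- e^-1) (is_derive_powRD (- e) (pos _ cz)).
  by rewrite /GRing.scale/= mulrA mulrNN mulVf ?mul1r//; exact: lt0r_neq0.
rewrite (@ge0_continuous_FTC2y _ _ (fun t => - e^-1 * (t + d) `^ (- e)) c 0).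
- by rewrite -EFinB sub0r mulNr opprK mulrC.
- by move=> z _; exact: powR_ge0.
- apply: continuous_in_subspaceT => z; rewrite inE/= in_itv/= andbT => cz.
  exact: (is_derive_continuous (is_derive_powRD _ (pos _ cz))).
- rewrite -[X in _ --> X](mulr0 (- e^-1)).
  by apply: cvgM; [exact: cvg_cst|exact: powRD_cvgy].
- by move=> z /ltW /dF [].
- by apply: cvg_at_right_filter; exact: (is_derive_continuous (dF _ _)).
- by move=> z; rewrite in_itv/= andbT => /ltW /dF ?; rewrite derive1E derive_val.
Qed.

Lemma integral_itv_FTC2 (f F : R -> R) c d : c < d ->
  {within `[c, d], continuous f} ->
  (forall z, c <= z <= d -> is_derive z 1 F (f z)) ->
  (\int[mu]_(x in `[c, d]) (f x)%:E = (F d - F c)%:E)%E.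
Proof.
move=> cd cf dF; rewrite (continuous_FTC2 cd cf (F := F)) ?EFinB//.
- split.
  + by move=> z; rewrite in_itv/= => /andP[/ltW ? /ltW ?]; apply: (@ex_derive _ _ _ _ _ _ _ (dF _ _)); apply/andP.
  + by apply: cvg_at_right_filter; apply: (is_derive_continuous (dF _ _)); rewrite lexx ltW.
  + by apply: cvg_at_left_filter; apply: (is_derive_continuous (dF _ _)); rewrite lexx ltW.
- move=> z; rewrite in_itv/= => /andP[/ltW ? /ltW ?]; rewrite derive1E.
  by apply: (@derive_val _ _ _ _ _ _ _ (dF _ _)); apply/andP.
Qed.

(* Exhausting an open interval by compact ones; this is how the singularity of
   the kernel at the endpoint is passed. *)
Lemma integral_oo_le (f : R -> R) a b M : 0 <= M ->
  measurable_fun setT f -> (forall x, 0 <= f x) ->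
  (forall c d, a < c -> c < d -> d < b ->
     (\int[mu]_(x in `[c, d]) (f x)%:E <= M%:E)%E) ->
  (\int[mu]_(x in `]a, b[) (f x)%:E <= M%:E)%E.
Proof.
move=> M0 mf f0 H.
pose S (n : nat) : set R := `[a + n.+1%:R^-1, b - n.+1%:R^-1]%classic.
have -> : `]a, b[%classic = \bigcup_n S n.
  apply/seteqP; split => x /=.
    rewrite in_itv/= => /andP[ax xb].
    pose r := Num.min (x - a) (b - x).
    have r0 : 0 < r by rewrite lt_min !subr_gt0 ax.
    exists (Num.bound r^-1) => //; rewrite /S/= in_itv/=.
    have Hr : (Num.bound r^-1).+1%:R^-1 <= r.
      rewrite -[leRHS]invrK lef_pV2 ?posrE ?invr_gt0//.
      apply: (le_trans (ltW (archi_boundP _))); first by rewrite invr_ge0 ltW.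
      by rewrite ler_nat.
    move: Hr; rewrite le_min => /andP[h1 h2].
    by rewrite -lerBrDl h1/= lerBrDr -lerBrDl h2.
  move=> [n _]; rewrite /S/= !in_itv/= => /andP[h1 h2].
  have n0 : 0 < n.+1%:R^-1 :> R by [].
  by rewrite (lt_le_trans _ h1) ?ltrDl//= (le_lt_trans h2)// gtrBl.
apply: (@cvge_le _ \oo _ R (fun i => (\int[mu]_(x in S i) (f x)%:E)%E)); last first.
  apply: ge0_nondecreasing_set_cvg_integral.
  - move=> n m nm; apply/subsetPset; apply: subset_itv; rewrite bnd_simp.
      by rewrite lerD2l lef_pV2 ?posrE// ler_nat.
    by rewrite lerD2l lerN2 lef_pV2 ?posrE// ler_nat.
  - by move=> n; exact: measurable_itv.
  - by move=> n; apply/measurable_EFinP; exact: measurable_funTS.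
  - by move=> n x _; rewrite lee_fin.
apply: nearW => n.
have n0 : 0 < n.+1%:R^-1 :> R by [].
(* For small [n] the compact interval shrinks to a point or is empty; its integral is then 0, and
   [0 <= M] settles the bound. *)
have [cd|] := ltP (a + n.+1%:R^-1) (b - n.+1%:R^-1).
  by apply: H => //; rewrite ?ltrDl ?gtrBl.
rewrite le_eqVlt => /predU1P[dc|dc].
  by rewrite /S dc set_itv1 integral_set1 lee_fin.
by rewrite /S set_itv_ge ?bnd_simp -?ltNge// integral_set0 lee_fin.
Qed.

(** Both endpoints are null sets, and strictly inside the interval the primitive is
    [- (x - t)^(1 - g) / (1 - g)]. Since [g < 1] it stays bounded up to the singularity at [x]; an
    upper bound is enough, so its contribution at the right end is dropped. *)
Lemma integral_powRB_le a x g : 0 < g < 1 -> a <= x ->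
  (\int[mu]_(s in `[a, x]) ((x - s) `^ (- g))%:E <= ((x - a) `^ (1 - g) / (1 - g))%:E)%E.
Proof.
move=> /andP[g0 g1] ax.
have mf : measurable_fun setT (fun s : R => (x - s) `^ (- g)).
  by apply: (measurableT_comp (measurable_powR (- g))); exact: measurable_funB.
rewrite -integral_itv_obnd_cbnd; last first.
  by apply/measurable_EFinP; exact: measurable_funTS.
rewrite -integral_itv_bndo_bndc; last first.
  by apply/measurable_EFinP; exact: measurable_funTS.
have g10 : 0 < 1 - g by rewrite subr_gt0.
apply: integral_oo_le => //.
- by rewrite divr_ge0 ?powR_ge0// ltW.
- by move=> s; exact: powR_ge0.
move=> c d ac cd dx.
pose F (t : R) := - (1 - g)^-1 * (x - t) `^ (1 - g).
apply: (@le_trans _ _ (F d - F c)%:E); last first.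
  rewrite /F lee_fin !mulNr opprK addrC -mulrBr [leRHS]mulrC ler_wpM2l ?invr_ge0 ?(ltW g10)//.
  apply: (@le_trans _ _ ((x - c) `^ (1 - g))); first by rewrite lerBlDr lerDl powR_ge0.
  by rewrite ge0_ler_powR ?nnegrE ?subr_ge0 ?(ltW g1) ?(ltW (lt_trans cd dx))// lerD2l lerN2 ltW.
rewrite le_eqVlt; apply/orP; left; apply/eqP; apply: integral_itv_FTC2 => //.
- apply: continuous_in_subspaceT => z; rewrite inE/= in_itv/= => /andP[_ zd].
  by apply: (is_derive_continuous (is_derive_powRB _ _)); rewrite subr_gt0 (le_lt_trans zd).
- move=> z /andP[_ zd].
  have zx : 0 < x - z by rewrite subr_gt0 (le_lt_trans zd).
  have := is_deriveZ (- (1 - g)^-1) (is_derive_powRB (1 - g) zx).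
  rewrite /GRing.scale/= mulrNN mulrA mulVf ?mul1r ?lt0r_neq0//.
  by rewrite addrAC subrr add0r.
Qed.

Lemma integral_powRD_le x b g : 0 < g < 1 -> x <= b ->
  (\int[mu]_(s in `[x, b]) ((s - x) `^ (- g))%:E <= ((b - x) `^ (1 - g) / (1 - g))%:E)%E.
Proof.
move=> /andP[g0 g1] xb.
have mf : measurable_fun setT (fun s : R => (s - x) `^ (- g)).
  by apply: (measurableT_comp (measurable_powR (- g))); exact: measurable_funB.
rewrite -integral_itv_obnd_cbnd; last first.
  by apply/measurable_EFinP; exact: measurable_funTS.
rewrite -integral_itv_bndo_bndc; last first.
  by apply/measurable_EFinP; exact: measurable_funTS.
have g10 : 0 < 1 - g by rewrite subr_gt0.
apply: integral_oo_le => //.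
- by rewrite divr_ge0 ?powR_ge0// ltW.
- by move=> s; exact: powR_ge0.
move=> c d xc cd db.
pose F (t : R) := (1 - g)^-1 * (t - x) `^ (1 - g).
apply: (@le_trans _ _ (F d - F c)%:E); last first.
  rewrite /F lee_fin -mulrBr [leRHS]mulrC ler_wpM2l ?invr_ge0 ?(ltW g10)//.
  apply: (@le_trans _ _ ((d - x) `^ (1 - g))); first by rewrite lerBlDr lerDl powR_ge0.
  by rewrite ge0_ler_powR ?nnegrE ?subr_ge0 ?(ltW g1) ?(ltW (lt_trans xc cd))// lerD2r ltW.
rewrite le_eqVlt; apply/orP; left; apply/eqP; apply: integral_itv_FTC2 => //.
- apply: continuous_in_subspaceT => z; rewrite inE/= in_itv/= => /andP[cz _].
  by apply: (is_derive_continuous (is_derive_powRD _ _)); rewrite subr_gt0 (lt_le_trans xc).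
- move=> z /andP[cz _].
  have zx : 0 < z - x by rewrite subr_gt0 (lt_le_trans xc).
  have := is_deriveZ ((1 - g)^-1) (is_derive_powRD (1 - g) zx).
  rewrite /GRing.scale/= mulrA mulVf ?mul1r ?lt0r_neq0//.
  by rewrite addrAC subrr add0r.
Qed.

End power_integrals.

(** * Positive semidefinite kernels as mixtures of rank-one kernels *)

Section mixture_form.
Local Open Scope ereal_scope.
Context {d1 d2 : measure_display} {T : measurableType d1} {Y : measurableType d2}
  {R : realType}.
Variables (m : {sigma_finite_measure set T -> \bar R})
  (n : {sigma_finite_measure set Y -> \bar R}).
Variables (phi : T * Y -> \bar R) (rho : Y -> \bar R).
Hypotheses (mphi : measurable_fun setT phi) (phi0 : forall z, 0 <= phi z).
Hypotheses (mrho : measurable_fun setT rho) (rho0 : forall y, 0 <= rho y).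

Let avg (q : T -> \bar R) (y : Y) : \bar R := \int[m]_x (q x * phi (x, y)).

Let avg_ge0 q y : (forall x, 0 <= q x) -> 0 <= avg q y.
Proof. by move=> q0; apply: integral_ge0 => x _; exact: mule_ge0. Qed.

Let measurable_qphi q : measurable_fun setT q ->
  measurable_fun setT (fun z : T * Y => q z.1 * phi z).
Proof.
by move=> mq; apply: emeasurable_funM => //; exact: (measurableT_comp mq).
Qed.

Let measurable_avg q : measurable_fun setT q -> (forall x, 0 <= q x) ->
  measurable_fun setT (avg q).
Proof.
move=> mq q0.
apply: (@measurable_fun_fubini_tonelli_G _ _ T Y R m (fun z : T * Y => q z.1 * phi z)).
  exact: measurable_qphi.
by move=> z; exact: mule_ge0.
Qed.

(** A superposition, with weights [rho y], of the rank-one kernels [phi (x, y) * phi (s, y)]: the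
    general shape of a kernel whose positivity can be read off. *)
Definition mixture_kernel (x s : T) : \bar R :=
  \int[n]_y (rho y * (phi (x, y) * phi (s, y))).

Definition mixture_form (q r : T -> \bar R) : \bar R :=
  \int[m]_x \int[m]_s (q x * (r s * mixture_kernel x s)).

(** Two applications of Tonelli, legitimate without any integrability since everything is
    nonnegative. For [q = r] the right-hand side is a weighted integral of squares. *)
Lemma mixture_form_sqr q r :
  measurable_fun setT q -> (forall x, 0 <= q x) ->
  measurable_fun setT r -> (forall x, 0 <= r x) ->
  mixture_form q r =
  \int[n]_y (rho y * (avg q y * avg r y)).
Proof.
move=> mq q0 mr r0.
have mphi2 x : measurable_fun setT (fun y => phi (x, y)) by exact: measurable_fun_pair2.
have mphi1 y : measurable_fun setT (fun x => phi (x, y)) by exact: measurable_fun_pair1.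
(* Halfway form: at fixed [x] the integrals over [s] and [y] have been exchanged, which produces
   [avg r y]. Exchanging [x] and [y] next produces [avg q y]. *)
transitivity (\int[m]_x \int[n]_y (rho y * (q x * phi (x, y) * avg r y))).
  apply: eq_integral => x _.
  pose F (z : T * Y) := rho z.2 * (q x * phi (x, z.2) * (r z.1 * phi z)).
  have F0 z : 0 <= F z by rewrite !mule_ge0.
  have mF : measurable_fun setT F.
    apply: emeasurable_funM; first exact: (measurableT_comp mrho).
    apply: emeasurable_funM; last exact: measurable_qphi.
    apply: emeasurable_funM; first exact: measurable_cst.
    exact: (measurableT_comp (mphi2 x)).
  transitivity (\int[m]_s \int[n]_y F (s, y)).
    apply: eq_integral => s _.
    have mG : measurable_fun setT (fun y => rho y * (phi (x, y) * phi (s, y))).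
      by apply: emeasurable_funM => //; exact: emeasurable_funM.
    have G0 y : 0 <= rho y * (phi (x, y) * phi (s, y)) by rewrite !mule_ge0.
    rewrite -ge0_integralZl// -ge0_integralZl//; last 2 first.
    - exact: measurable_funeM.
    - by move=> y _; rewrite mule_ge0.
    apply: eq_integral => y _; rewrite /F/=.
    rewrite (muleCA (r s)) (muleCA (q x)); congr (_ * _).
    by rewrite (muleCA (r s)) muleA.
  rewrite -fubini_tonelli1// fubini_tonelli2//.
  apply: eq_integral => y _; rewrite /fubini_G/F/=.
  have mG : measurable_fun setT (fun s => r s * phi (s, y)) by exact: emeasurable_funM.
  have G0 s : 0 <= r s * phi (s, y) by rewrite mule_ge0.
  rewrite ge0_integralZl//; last 2 first.
  - exact: measurable_funeM.
  - by move=> s _; rewrite !mule_ge0.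
  by rewrite ge0_integralZl// mule_ge0.
pose F (z : T * Y) := rho z.2 * (q z.1 * phi z * avg r z.2).
have F0 z : 0 <= F z by rewrite !mule_ge0// avg_ge0.
have mF : measurable_fun setT F.
  apply: emeasurable_funM; first exact: (measurableT_comp mrho).
  apply: emeasurable_funM; first exact: measurable_qphi.
  exact: (measurableT_comp (measurable_avg mr r0)).
transitivity (\int[m]_x \int[n]_y F (x, y)); first by [].
rewrite -fubini_tonelli1// fubini_tonelli2//.
apply: eq_integral => y _; rewrite /fubini_G/F/=.
rewrite ge0_integralZl//; last 2 first.
- by apply: emeasurable_funM => //; apply: emeasurable_funM.
- by move=> x _; rewrite !mule_ge0// avg_ge0.
congr (_ * _).
under eq_integral do rewrite muleC.
rewrite ge0_integralZl//; last 3 first.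
- exact: emeasurable_funM.
- by move=> x _; rewrite !mule_ge0.
- exact: avg_ge0.
by rewrite muleC.
Qed.

(** This is [(a - b)^2 >= 0] with the cross terms moved to the left, because [a - b] is meaningless
    when both are infinite. As soon as one of them is infinite, so is the right-hand side. *)
Let mule2_le_sqr (a b : \bar R) : 0 <= a -> 0 <= b -> a * b + a * b <= a * a + b * b.
Proof.
case: a => [a| |]; case: b => [b| |]// a0 b0.
- rewrite -!EFinM -!EFinD lee_fin -subr_ge0.
  have -> : (a * a + b * b - (a * b + a * b) = (a - b) ^+ 2)%R by ring.
  exact: sqr_ge0.
- by rewrite mulyy addey ?leey// -ltNye (lt_le_trans _ (mule_ge0 a0 a0)).
- by rewrite mulyy addye ?leey// -ltNye (lt_le_trans _ (mule_ge0 b0 b0)).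
Qed.

Let integral_mule2_le (u v : Y -> \bar R) :
  measurable_fun setT u -> (forall y, 0 <= u y) ->
  measurable_fun setT v -> (forall y, 0 <= v y) ->
  \int[n]_y (rho y * (u y * v y)) + \int[n]_y (rho y * (v y * u y)) <=
  \int[n]_y (rho y * (u y * u y)) + \int[n]_y (rho y * (v y * v y)).
Proof.
move=> mu u0 mv v0.
pose G (u' v' : Y -> \bar R) y := rho y * (u' y * v' y).
have mG u' v' : measurable_fun setT u' -> measurable_fun setT v' ->
    measurable_fun setT (G u' v').
  by move=> *; apply: emeasurable_funM => //; exact: emeasurable_funM.
have G0 u' v' : (forall y, 0 <= u' y) -> (forall y, 0 <= v' y) -> forall y, 0 <= G u' v' y.
  by move=> *; rewrite /G !mule_ge0.
have addE (F H : Y -> \bar R) : measurable_fun setT F -> (forall y, 0 <= F y) ->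
    measurable_fun setT H -> (forall y, 0 <= H y) ->
    \int[n]_y F y + \int[n]_y H y = \int[n]_y (F y + H y).
  by move=> mF F0 mH H0; rewrite ge0_integralD.
rewrite (addE (G u v) (G v u)); [|exact: mG|exact: G0|exact: mG|exact: G0].
rewrite (addE (G u u) (G v v)); [|exact: mG|exact: G0|exact: mG|exact: G0].
apply: ge0_le_integral => //.
- by move=> y _; apply: adde_ge0; exact: G0.
- by apply: emeasurable_funD; exact: mG.
- by apply: emeasurable_funD; exact: mG.
move=> y _; rewrite /G -ge0_muleDr ?mule_ge0// -ge0_muleDr ?mule_ge0//.
rewrite (muleC (v y) (u y)).
by apply: lee_wpmul2l => //; exact: mule2_le_sqr.
Qed.

(** Positivity of the form at [q - r], expanded and rearranged so that no possibly infinite quantity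
    is subtracted. *)
Lemma mixture_form_le q r :
  measurable_fun setT q -> (forall x, 0 <= q x) ->
  measurable_fun setT r -> (forall x, 0 <= r x) ->
  mixture_form q r + mixture_form r q <= mixture_form q q + mixture_form r r.
Proof.
move=> mq q0 mr r0.
have := integral_mule2_le (measurable_avg mq q0) (fun y => avg_ge0 y q0)
  (measurable_avg mr r0) (fun y => avg_ge0 y r0).
by rewrite -(mixture_form_sqr mq q0 mr r0) -(mixture_form_sqr mr r0 mq q0)
  -(mixture_form_sqr mq q0 mq q0) -(mixture_form_sqr mr r0 mr r0).
Qed.

End mixture_form.

(** * The Riesz kernel as a mixture of interval indicators *)

Section riesz_kernel.
Context {R : realType}.
Notation mu := (@lebesgue_measure R).
Notation RM := (measurableTypeR R).
Implicit Types (g x s : R).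

(** The mixing measure on the space of intervals. It carries its own name so that the sigma-finite
    structure required of a mixing measure can be attached to it. *)
Definition plane_measure : set (RM * RM) -> \bar R := (mu \x mu)%E.

HB.instance Definition _ := Measure.on plane_measure.

Let sigma_finite_plane_measure : sigma_finite setT plane_measure.
Proof.
pose I (k : nat) : set RM := `[- k%:R, k%:R]%classic.
exists (fun k => I k `*` I k).
  apply/esym; rewrite -subTset => -[x y] _.
  exists (maxn (Num.bound `|x|) (Num.bound `|y|)) => //.
  have B z m : (Num.bound `|z| <= m)%N -> I m z.
    move=> zm; rewrite /I/= in_itv/= -ler_norml.
    apply: (@le_trans _ _ (Num.bound `|z|)%:R); last by rewrite ler_nat.
    by apply/ltW/archi_boundP.
  by split; apply: B; rewrite ?leq_maxl ?leq_maxr.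
move=> k; have mI : measurable (I k) by exact: measurable_itv.
split; first exact: measurableX.
rewrite /plane_measure product_measure1E//= /I lebesgue_measure_itv/=.
by case: ifP => _; rewrite -?EFinD -?EFinM ?mule0 ltry.
Qed.

HB.instance Definition _ := Measure_isSigmaFinite.Build _ _ _ plane_measure
  sigma_finite_plane_measure.

(* [straddle (x, (y, w))] is the indicator of [-y <= x <= w]: the intervals
   containing [x] are parametrised by minus their left endpoint, so that both
   integrations below run over a half-line [c, +oo[. *)
Definition straddle (z : RM * (RM * RM)) : \bar R :=
  (((- z.1 <= z.2.1) && (z.1 <= z.2.2))%:R : R)%:E.

(** A power of the interval length [y.2 + y.1], the first coordinate being minus the left endpoint.
    The exponent is [- g - 2] in the shape of [integral_powRD_y] for [e = g + 1]. For negative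
    lengths the value is irrelevant, as such an interval contains no point. *)
Definition straddle_weight g (y : RM * RM) : \bar R := ((y.2 + y.1) `^ (- (g + 1) - 1))%:E.

Lemma straddle_ge0 z : (0 <= straddle z)%E.
Proof. by rewrite lee_fin. Qed.

Lemma straddle_weight_ge0 g y : (0 <= straddle_weight g y)%E.
Proof. by rewrite lee_fin powR_ge0. Qed.

Lemma measurable_straddle : measurable_fun setT straddle.
Proof.
apply/measurable_EFinP.
rewrite (_ : (fun _ => _) = (fun z : RM * (RM * RM) => if (- z.1 <= z.2.1) && (z.1 <= z.2.2) then 1 else 0 : R)).
  apply: measurable_fun_ifT => //.
  apply: measurable_and.
  - apply: measurable_fun_ler.
    + by apply: measurableT_comp => //; exact: measurable_fst.
    + by apply: (measurableT_comp measurable_fst); exact: measurable_snd.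
  - apply: measurable_fun_ler; first exact: measurable_fst.
    by apply: (measurableT_comp measurable_snd); exact: measurable_snd.
by apply/funext => z /=; case: ifPn.
Qed.

Lemma measurable_straddle_weight g : measurable_fun setT (straddle_weight g).
Proof.
apply/measurable_EFinP; apply: (measurableT_comp (measurable_powR _)).
by apply: measurable_funD; [exact: measurable_snd|exact: measurable_fst].
Qed.

(** An interval contains both [x] and [s] exactly when it contains [lo] and [hi], so the integrand
    lives on the quadrant [y >= - lo], [w >= hi]. The distance [hi - lo] is positive off the
    diagonal, which keeps both power integrals convergent. *)
Lemma straddle_kernelE g x s : 0 < g -> x != s ->
  mixture_kernel plane_measure straddle (straddle_weight g) x s =
  (`|x - s| `^ (- g) / (g * (g + 1)))%:E.
Proof.
move=> g0 xs; rewrite /mixture_kernel.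
pose hi := Num.max x s; pose lo := Num.min x s.
have hl : hi - lo = `|x - s|.
  rewrite /hi /lo; have [h|h] := leP x s.
    by rewrite ler0_norm ?opprB// subr_le0.
  by rewrite gtr0_norm// subr_gt0.
have hl0 : 0 < hi + - lo by rewrite hl normr_gt0 subr_eq0.
have g10 : 0 < g + 1 by rewrite addr_gt0.
pose F (y : RM * RM) := (straddle_weight g y * (straddle (x, y) * straddle (s, y)))%E.
have mF : measurable_fun setT F.
  apply: emeasurable_funM; first exact: measurable_straddle_weight.
  by apply: emeasurable_funM; apply: measurable_fun_pair2; exact: measurable_straddle.
have F0 y : (0 <= F y)%E by rewrite !mule_ge0 ?straddle_ge0 ?straddle_weight_ge0.
transitivity (\int[mu]_y fubini_F mu F y)%E; first exact: (@fubini_tonelli1 _ _ RM RM R mu mu F mF F0).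
(* The inner integration over [w] gives the factor [1 / (g + 1)]; the outer one over [y] will give
   [1 / g]. *)
transitivity (\int[mu]_(y in `[(- lo)%R, +oo[) ((g + 1)^-1%:E * ((y + hi) `^ (- g - 1))%:E))%E.
  rewrite [RHS]integral_mkcond; apply: eq_integral => y _; rewrite /fubini_F patchE.
  have FE w : F (y, w) = if (- lo <= y) && (hi <= w) then ((w + y) `^ (- (g + 1) - 1))%:E else 0.
    rewrite /F /straddle /straddle_weight/= -!EFinM -natrM mulnb.
    rewrite (_ : _ && _ = (- lo <= y) && (hi <= w)); last first.
      by rewrite /lo /hi ge_max oppr_min ge_max andbACA.
    by case: ifP; rewrite ?mulr1 ?mulr0.
  case: ifPn => [|]; rewrite mem_setE in_itv/= andbT => ly; last first.
    by apply: integral0_eq => w _; rewrite FE (negbTE ly).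
  transitivity (\int[mu]_(w in `[hi, +oo[) ((w + y) `^ (- (g + 1) - 1))%:E)%E.
    rewrite [RHS]integral_mkcond; apply: eq_integral => w _.
    by rewrite patchE mem_setE in_itv/= andbT FE ly/=.
  rewrite integral_powRD_y//; last by rewrite (lt_le_trans hl0)// lerD2l.
  by rewrite -EFinM mulrC (addrC hi) opprD.
rewrite ge0_integralZl//.
- rewrite integral_powRD_y// 1?addrC// -EFinM -hl mulrC -mulrA; congr (_ * _)%:E.
    by congr (_ `^ _); rewrite addrC.
  by rewrite invfM.
- apply/measurable_EFinP; apply: measurable_funTS.
  by apply: (measurableT_comp (measurable_powR _)); exact: measurable_funD.
- by move=> y _; rewrite lee_fin powR_ge0.
- by rewrite lee_fin invr_ge0 ltW.
Qed.
End riesz_kernel.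

(** * Nonnegativity of the Riesz form on bounded functions supported in an interval *)

Section riesz_form.
Context {R : realType}.
Notation mu := (@lebesgue_measure R).
Implicit Types (a b g x s M : R) (p q r : R -> R).

(** A class containing the piecewise polynomials extended by 0 and stable under differences and
    under positive and negative parts. The support condition allows integrals over the whole line,
    as in [mixture_form]. *)
Definition bounded_supp a b M p := [/\ measurable_fun setT p,
  forall x, `|p x| <= M & forall x, x \notin `[a, b] -> p x = 0].

Lemma integral_supp a b (f : R -> \bar R) : (forall x, x \notin `[a, b] -> f x = 0%E) ->
  (\int[mu]_x f x = \int[mu]_(x in `[a, b]) f x)%E.
Proof.
move=> f0; rewrite [RHS]integral_mkcond; apply: eq_integral => x _.
by rewrite patchE mem_setE; case: ifPn => // /f0.
Qed.

Lemma Rintegral_supp a b p : (forall x, x \notin `[a, b] -> p x = 0) ->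
  \int[mu]_x p x = \int[mu]_(x in `[a, b]) p x.
Proof. by move=> p0; rewrite /Rintegral (@integral_supp a b)// => x /p0 ->. Qed.

Lemma integrable_supp a b p : (forall x, x \notin `[a, b] -> p x = 0) ->
  mu.-integrable `[a, b] (EFin \o p) -> mu.-integrable setT (EFin \o p).
Proof.
move=> p0 ip.
have -> : EFin \o p = (EFin \o p) \_ `[a, b].
  by apply/funext => x; rewrite patchE mem_setE; case: ifPn => //= /p0 ->.
by rewrite -integrable_mkcond.
Qed.

Lemma bounded_supp_ge0 a b M p : bounded_supp a b M p -> 0 <= M.
Proof. by case=> _ pM _; rewrite (le_trans _ (pM 0)). Qed.

Lemma bounded_supp_integrable a b M p : bounded_supp a b M p ->
  mu.-integrable setT (EFin \o p).
Proof.
move=> [mp pM p0]; apply: (integrable_supp p0).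
apply: measurable_bounded_integrable => //.
- have [ab|ba] := leP a b; last by rewrite set_itv_ge ?bnd_simp -?ltNge// measure0.
  suff : (mu `[a, b] < +oo)%E by [].
  by rewrite lebesgue_measure_itv/=; case: ifP => // _; rewrite -EFinD ltry.
- exact: measurable_funTS.
- by exists M; split => [|z Mz x _ /=]; [exact: num_real|exact: le_trans (pM x) (ltW Mz)].
Qed.

Lemma bounded_suppB a b M N p q : bounded_supp a b M p -> bounded_supp a b N q ->
  bounded_supp a b (M + N) (fun x => p x - q x).
Proof.
move=> [mp pM p0] [mq qM q0]; split; first exact: measurable_funB.
- by move=> x; rewrite (le_trans (ler_normB _ _))// lerD.
- by move=> x xab; rewrite p0// q0// subrr.
Qed.

Lemma bounded_supp_pos a b M p : bounded_supp a b M p -> bounded_supp a b M p^\+.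
Proof.
move=> [mp pM p0]; split; first exact: measurable_funrpos.
- move=> x; rewrite /funrpos; apply: le_trans (pM x).
  by have [h|h] := leP 0 (p x); rewrite ?normr0.
- by move=> x /p0; rewrite /funrpos => ->; rewrite maxxx.
Qed.

Lemma bounded_supp_neg a b M p : bounded_supp a b M p -> bounded_supp a b M p^\-.
Proof.
move=> [mp pM p0]; split; first exact: measurable_funrneg.
- move=> x; rewrite /funrneg; apply: le_trans (pM x).
  by have [h|h] := leP 0 (- p x); rewrite ?normr0 ?normrN.
- by move=> x /p0; rewrite /funrneg => ->; rewrite oppr0 maxxx.
Qed.

(** The Riesz potential of order [1 - g] on the line, without its normalising constant. *)
Definition riesz g p x : R := \int[mu]_s (`|x - s| `^ (- g) * p s).

Lemma measurable_riesz_kernel g x : measurable_fun setT (fun s => `|x - s| `^ (- g) : R).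
Proof.
apply: (measurableT_comp (measurable_powR _)).
by apply: measurableT_comp => //; exact: measurable_funB.
Qed.

(** The factor 2 counts the two sides of the singularity, each contributing at most
    [(b - a)^(1 - g) / (1 - g)]. *)
Definition riesz_bound a b g : R := 2 * (b - a) `^ (1 - g) / (1 - g).

Lemma riesz_bound_ge0 a b g : g < 1 -> 0 <= riesz_bound a b g.
Proof. by move=> g1; rewrite divr_ge0 ?mulr_ge0 ?powR_ge0// subr_ge0 ltW. Qed.

Lemma integral_riesz_kernel_le a b g x : 0 < g < 1 -> x \in `[a, b] ->
  (\int[mu]_(s in `[a, b]) (`|x - s| `^ (- g))%:E <= (riesz_bound a b g)%:E)%E.
Proof.
move=> g01; rewrite in_itv/= => /andP[ax xb].
have ab := le_trans ax xb.
have [g0 g1] := andP g01.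
have g10 : 0 < 1 - g by rewrite subr_gt0.
have mk (D : set R) : measurable D -> measurable_fun D (fun s => (`|x - s| `^ (- g))%:E).
  by move=> mD; apply/measurable_EFinP; apply: measurable_funTS; exact: measurable_riesz_kernel.
rewrite (@itv_bndbnd_setU _ _ _ (BRight x)) ?bnd_simp//.
rewrite ge0_integral_setU//=; last 2 first.
- by apply: mk; exact: measurableU.
- apply/disj_setPS => y [/=]; rewrite !in_itv/= => /andP[_ yx] /andP[].
  by rewrite ltNge yx.
rewrite (_ : riesz_bound a b g = (b - a) `^ (1 - g) / (1 - g) + (b - a) `^ (1 - g) / (1 - g)); last first.
  by rewrite /riesz_bound -mulrA mulr2n mulrDl mul1r.
rewrite EFinD; apply: leeD.
- under eq_integral => s.
    rewrite inE/= in_itv/= => /andP[_ sx]; rewrite (_ : `|x - s| = x - s); last first.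
      by rewrite ger0_norm// subr_ge0.
    over.
  apply: (le_trans (integral_powRB_le g01 ax)).
  rewrite lee_fin ler_wpM2r ?invr_ge0 ?(ltW g10)//.
  by rewrite ge0_ler_powR ?(ltW g10)// ?nnegrE ?subr_ge0// lerD2r.
- rewrite integral_itv_obnd_cbnd; last exact: mk.
  under eq_integral => s.
    rewrite inE/= in_itv/= => /andP[xs _]; rewrite (_ : `|x - s| = s - x); last first.
      by rewrite distrC ger0_norm// subr_ge0.
    over.
  apply: (le_trans (integral_powRD_le g01 xb)).
  rewrite lee_fin ler_wpM2r ?invr_ge0 ?(ltW g10)//.
  by rewrite ge0_ler_powR ?(ltW g10)// ?nnegrE ?subr_ge0// lerD2l lerN2.
Qed.

Lemma integral_riesz_abs_le a b g M p x : 0 < g < 1 -> x \in `[a, b] ->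
  bounded_supp a b M p ->
  (\int[mu]_s (`| `|x - s| `^ (- g) * p s |)%:E <= (M * riesz_bound a b g)%:E)%E.
Proof.
move=> g01 xab bp; have M0 := bounded_supp_ge0 bp; case: bp => mp pM p0.
rewrite (@integral_supp a b); last by move=> s /p0 ->; rewrite mulr0 normr0.
apply: (@le_trans _ _ (\int[mu]_(s in `[a, b]) (M%:E * (`|x - s| `^ (- g))%:E))%E).
  apply: ge0_le_integral => //.
  - by apply/measurable_EFinP; apply: measurable_funTS; apply: measurableT_comp => //;
      apply: measurable_funM => //; exact: measurable_riesz_kernel.
  - by apply: measurable_funeM; apply/measurable_EFinP; apply: measurable_funTS;
      exact: measurable_riesz_kernel.
  - move=> s _; rewrite -EFinM lee_fin normrM ger0_norm ?powR_ge0// mulrC.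
    by rewrite ler_wpM2r// powR_ge0.
have mk : measurable_fun `[a, b] (fun s => (`|x - s| `^ (- g))%:E).
  by apply/measurable_EFinP; apply: measurable_funTS; exact: measurable_riesz_kernel.
rewrite (ge0_integralZl mu _ mk)//.
by rewrite EFinM lee_wpmul2l ?lee_fin//; exact: integral_riesz_kernel_le.
Qed.

Lemma riesz_integrable a b g M p x : 0 < g < 1 -> x \in `[a, b] ->
  bounded_supp a b M p ->
  mu.-integrable setT (EFin \o (fun s => `|x - s| `^ (- g) * p s)).
Proof.
move=> g01 xab bp; apply/integrableP; split.
  apply/measurable_EFinP; apply: measurable_funM; first exact: measurable_riesz_kernel.
  by case: bp.
exact: (le_lt_trans (integral_riesz_abs_le g01 xab bp) (ltry _)).
Qed.

Lemma riesz_le a b g M p x : 0 < g < 1 -> x \in `[a, b] -> bounded_supp a b M p ->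
  `|riesz g p x| <= M * riesz_bound a b g.
Proof.
move=> g01 xab bp; rewrite -lee_fin /riesz.
rewrite EFin_normr_Rintegral//; last exact: riesz_integrable bp.
apply: le_trans (integral_riesz_abs_le g01 xab bp).
by apply: le_abse_integral => //; have /integrableP[] := riesz_integrable g01 xab bp.
Qed.

Lemma rieszB a b g M N p q x : 0 < g < 1 -> x \in `[a, b] ->
  bounded_supp a b M p -> bounded_supp a b N q ->
  riesz g (fun x => p x - q x) x = riesz g p x - riesz g q x.
Proof.
move=> g01 xab bp bq; rewrite /riesz -RintegralB//.
- by apply: eq_Rintegral => s _; rewrite mulrBr.
- exact: riesz_integrable bp.
- exact: riesz_integrable bq.
Qed.

Lemma measurable_riesz_kernel2 g :
  measurable_fun setT (fun z : measurableTypeR R * measurableTypeR R => `|z.1 - z.2| `^ (- g) : R).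
Proof.
apply: (measurableT_comp (measurable_powR _)).
apply: measurableT_comp => //; apply: measurable_funB; [exact: measurable_fst|exact: measurable_snd].
Qed.

(** Measurability of a parametrised integral comes from Tonelli, hence the sign condition;
    [bounded_supp_mul_riesz] treats signed functions through their positive and negative parts. *)
Lemma measurable_riesz g p : measurable_fun setT p -> (forall x, 0 <= p x) ->
  measurable_fun setT (riesz g p).
Proof.
move=> mp p0; apply: (measurableT_comp (fine_measurable measurableT)).
pose F (z : measurableTypeR R * measurableTypeR R) : \bar R := (`|z.1 - z.2| `^ (- g) * p z.2)%:E.
apply: (@measurable_fun_fubini_tonelli_F _ _ (measurableTypeR R) (measurableTypeR R) R mu F).
  apply/measurable_EFinP; apply: measurable_funM; first exact: measurable_riesz_kernel2.
  by apply: (measurableT_comp mp); exact: measurable_snd.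
by move=> z; rewrite lee_fin mulr_ge0 ?powR_ge0.
Qed.

Lemma bounded_suppM_riesz a b g M N p q : 0 < g < 1 ->
  bounded_supp a b M p -> bounded_supp a b N q -> (forall x, 0 <= q x) ->
  bounded_supp a b (M * (N * riesz_bound a b g)) (fun x => p x * riesz g q x).
Proof.
move=> g01 bp bq q0; have [mp pM p0] := bp; have [mq _ _] := bq; split.
- by apply: measurable_funM => //; exact: measurable_riesz.
- move=> x; have [xab|xab] := boolP (x \in `[a, b]).
    by rewrite normrM ler_pM// riesz_le.
  rewrite p0// mul0r normr0 mulr_ge0 ?(bounded_supp_ge0 bp)//.
  rewrite mulr_ge0 ?(bounded_supp_ge0 bq)// riesz_bound_ge0//.
  by case/andP: g01.
- by move=> x /p0 ->; rewrite mul0r.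
Qed.

(** The passage from the extended-real form to the real one: boundedness and support make every
    integral finite, so that [fine] loses nothing. *)
Lemma mixture_form_riesz a b g M N p q : 0 < g < 1 ->
  bounded_supp a b M p -> (forall x, 0 <= p x) ->
  bounded_supp a b N q -> (forall x, 0 <= q x) ->
  mixture_form mu plane_measure straddle (straddle_weight g) (EFin \o p) (EFin \o q) =
  ((g * (g + 1))^-1 * \int[mu]_x (p x * riesz g q x))%:E.
Proof.
move=> g01 bp p0 bq q0; have [g0 g1] := andP g01.
have C0 : 0 <= (g * (g + 1))^-1 by rewrite invr_ge0 mulr_ge0 ?addr_ge0 ?ltW.
have bpq := bounded_suppM_riesz g01 bp bq q0.
have ipq := bounded_supp_integrable bpq.
have [mp _ ps] := bp; have [mq _ qs] := bq.
have pq0 x : 0 <= p x * riesz g q x.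
  by rewrite mulr_ge0// Rintegral_ge0// => s _; rewrite mulr_ge0 ?powR_ge0.
transitivity (\int[mu]_x ((g * (g + 1))^-1%:E * (p x * riesz g q x)%:E))%E; last first.
  rewrite ge0_integralZl//.
  - by rewrite EFinM /Rintegral fineK//; exact: integrable_fin_num.
  - by apply/measurable_EFinP; case: bpq.
  - by move=> x _; rewrite lee_fin.
apply: eq_integral => x _.
have [xab|xab] := boolP (x \in `[a, b]); last first.
  by rewrite ps// mul0r mule0 /= ps//; apply: integral0_eq => s _; rewrite mul0e.
have mk : measurable_fun (setT : set R)
    (fun s => ((g * (g + 1))^-1 * p x)%:E * (`|x - s| `^ (- g) * q s)%:E)%E.
  apply: measurable_funeM; apply/measurable_EFinP; apply: measurable_funM => //.
  exact: measurable_riesz_kernel.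
(* The kernel formula holds for [s != x] only; the single point [x] is a null set and is removed
   from both integrals. *)
have kE : {in (setT : set R) `\ x, forall s,
    ((g * (g + 1))^-1 * p x)%:E * (`|x - s| `^ (- g) * q s)%:E =
    (p x)%:E * ((q s)%:E * mixture_kernel plane_measure straddle (straddle_weight g) x s)}%E.
  move=> s; rewrite inE/= => -[_ /eqP sx].
  rewrite straddle_kernelE 1?eq_sym// -!EFinM; congr EFin.
  by set c := (g * (g + 1))^-1; ring.
transitivity (\int[mu]_s (((g * (g + 1))^-1 * p x)%:E * (`|x - s| `^ (- g) * q s)%:E))%E.
  have mD : measurable ((setT : set R) `\ x) by exact: measurableD.
  have mk1 : measurable_fun ((setT : set R) `\ x)
      (fun s => ((g * (g + 1))^-1 * p x)%:E * (`|x - s| `^ (- g) * q s)%:E)%E.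
    exact: measurable_funTS.
  have mk2 := eq_measurable_fun _ kE mk1.
  rewrite -(integral_setD1 mD mk2) -[RHS](integral_setD1 mD mk1).
  by apply: eq_integral => s sD; rewrite kE.
have Cp0 : (0 <= ((g * (g + 1))^-1 * p x)%:E)%E by rewrite lee_fin mulr_ge0.
rewrite ge0_integralZl//; last 2 first.
- by apply/measurable_EFinP; apply: measurable_funM => //; exact: measurable_riesz_kernel.
- by move=> s _; rewrite lee_fin mulr_ge0 ?powR_ge0.
rewrite -[X in (_ * X)%E]fineK; last exact: integrable_fin_num (riesz_integrable g01 xab bq).
by rewrite -!EFinM -mulrA.
Qed.

(** With [p = q - r] split into positive and negative parts, the form expands into four finite
    terms, and [mixture_form_le] states exactly that the mixed ones do not exceed the pure ones. *)
Lemma riesz_form_ge0 a b g M p : 0 < g < 1 -> bounded_supp a b M p ->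
  0 <= \int[mu]_x (p x * riesz g p x).
Proof.
move=> g01 bp; have [g0 g1] := andP g01.
have bq := bounded_supp_pos bp; have br := bounded_supp_neg bp.
have q0 x : 0 <= p^\+ x by exact: funrpos_ge0.
have r0 x : 0 <= p^\- x by exact: funrneg_ge0.
set q := p^\+ in bq q0; set r := p^\- in br r0.
pose X (u v : R -> R) := \int[mu]_x (u x * riesz g v x).
have HX : X q r + X r q <= X q q + X r r.
  have mq : measurable_fun setT (EFin \o q) by apply/measurable_EFinP; case: bq.
  have mr : measurable_fun setT (EFin \o r) by apply/measurable_EFinP; case: br.
  have := mixture_form_le mu plane_measure measurable_straddle straddle_ge0
    (measurable_straddle_weight g) (straddle_weight_ge0 g) mq q0 mr r0.
  rewrite (mixture_form_riesz g01 bq q0 br r0) (mixture_form_riesz g01 br r0 bq q0).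
  rewrite (mixture_form_riesz g01 bq q0 bq q0) (mixture_form_riesz g01 br r0 br r0).
  rewrite -/(X q r) -/(X r q) -/(X q q) -/(X r r).
  move: (X q r) (X r q) (X q q) (X r r) => A B C D.
  rewrite -!EFinD lee_fin -!mulrDr ler_pM2l//.
  by rewrite invr_gt0 mulr_gt0// addr_gt0.
have bM u v : bounded_supp a b M u -> bounded_supp a b M v -> (forall x, 0 <= v x) ->
  bounded_supp a b (M * (M * riesz_bound a b g)) (fun x => u x * riesz g v x).
  exact: bounded_suppM_riesz.
have bi u L : bounded_supp a b L u -> mu.-integrable setT (EFin \o u).
  exact: bounded_supp_integrable.
have b1 := bounded_suppB (bM _ _ bq bq q0) (bM _ _ bq br r0).
have b2 := bounded_suppB (bM _ _ br bq q0) (bM _ _ br br r0).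
suff -> : \int[mu]_x (p x * riesz g p x) = X q q - X q r - (X r q - X r r).
  by move: (X q r) (X r q) (X q q) (X r r) HX => A B C D; lra.
rewrite /X -(RintegralB measurableT (bi _ _ (bM _ _ bq bq q0)) (bi _ _ (bM _ _ bq br r0))).
rewrite -(RintegralB measurableT (bi _ _ (bM _ _ br bq q0)) (bi _ _ (bM _ _ br br r0))).
rewrite -(RintegralB measurableT (bi _ _ b1) (bi _ _ b2)).
have pE : p = (fun x => q x - r x) by rewrite -[LHS]funrposBneg.
apply: eq_Rintegral => x _.
have [xab|xab] := boolP (x \in `[a, b]).
  by rewrite {1 2}pE (rieszB g01 xab bq br); ring.
have [_ _ ->//] := bp; have [_ _ ->//] := bq; have [_ _ ->//] := br.
by rewrite !mul0r !subrr.
Qed.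

End riesz_form.

(** * Integrals over adjacent intervals *)

Section interval_integrals.
Context {R : realType}.
Notation mu := (@lebesgue_measure R).
Implicit Types (x y z : R) (f h : R -> R).

Lemma continuous_integrable_itv x y f : continuous f ->
  mu.-integrable `[x, y] (EFin \o f).
Proof.
move=> cf; apply: continuous_compact_integrable; first exact: segment_compact.
exact: continuous_subspaceT.
Qed.

(** Agreement on the half-open interval suffices because the right end is a null set. This matches
    [pw], which coincides with the polynomial of a cell only up to, and not at, its right node. *)
Lemma Rint_itv_eq x y f h : {in `[x, y[, f =1 h} -> measurable_fun `[x, y[ f ->
  Rint `[x, y] f = Rint `[x, y] h.
Proof.
move=> fh mf; rewrite /Rint /Rintegral; congr fine.
have fh' : {in `[x, y[%classic, EFin \o f =1 EFin \o h} by move=> s; rewrite inE/= => /fh ->.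
have mf' : measurable_fun `[x, y[ (EFin \o f) by apply/measurable_EFinP.
rewrite -integral_itv_bndo_bndc// -[RHS]integral_itv_bndo_bndc//; last first.
  exact: eq_measurable_fun fh' mf'.
exact: eq_integral.
Qed.

Lemma Rint_itv_cat x y z f : x <= y -> y <= z ->
  mu.-integrable `[x, z] (EFin \o f) ->
  Rint `[x, z] f = Rint `[x, y] f + Rint `[y, z] f.
Proof.
move=> xy yz ifz.
have := @Rintegral_itvB R f (BLeft x) (BRight z) y ifz.
rewrite !bnd_simp => /(_ xy yz) H.
rewrite /Rint -(Rintegral_itv_obnd_cbnd (r := y)); last first.
  by apply: integrableS ifz => //; apply: subset_itvr; rewrite bnd_simp.
by rewrite -H addrC subrK.
Qed.

End interval_integrals.

(** * Piecewise polynomials on the mesh and the form of the fractional operator *)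

Section mesh.
Context {R : realType}.
Notation mu := (@lebesgue_measure R).
Variables (K : nat) (node : nat -> R) (a b : R).
Hypothesis mesh : mesh_ok K node a b.

Let node0 : node 0%N = a. Proof. by case: mesh => _ []. Qed.
Let nodeK : node K = b. Proof. by case: mesh => _ [_ []]. Qed.
Let node_lt i : (i < K)%N -> node i < node i.+1.
Proof. by case: mesh => _ [_ [_]]; exact. Qed.

Lemma node_le i j : (i <= j)%N -> (j <= K)%N -> node i <= node j.
Proof.
elim: j => [|j IH]; first by rewrite leqn0 => /eqP ->.
rewrite leq_eqVlt => /predU1P[-> //|]; rewrite ltnS => ij jK.
by rewrite (le_trans (IH ij (ltnW jK)))// ltW// node_lt.
Qed.

Lemma node_ge_a i : (i <= K)%N -> a <= node i.
Proof. by move=> iK; rewrite -node0 node_le. Qed.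

Lemma node_le_b i : (i <= K)%N -> node i <= b.
Proof. by move=> iK; rewrite -nodeK node_le. Qed.

Lemma Rint_mesh (f : R -> R) : mu.-integrable `[a, b] (EFin \o f) ->
  Rint `[a, b] f = \sum_(i < K) Rint `[node i, node i.+1] f.
Proof.
move=> fi.
suff H k : (k <= K)%N -> Rint `[a, node k] f = \sum_(i < k) Rint `[node i, node i.+1] f.
  by rewrite -H// nodeK.
elim: k => [_|k IH kK].
  by rewrite big_ord0 node0 set_itv1 /Rint Rintegral_set1.
rewrite big_ord_recr/= -IH 1?ltnW//.
apply: Rint_itv_cat; [exact/node_ge_a/ltnW|exact/ltW/node_lt|].
by apply: integrableS fi => //; apply: subset_itvl; rewrite bnd_simp node_le_b.
Qed.

Lemma pw_cell (U : nat -> {poly R}) i x : (i < K)%N -> node i <= x < node i.+1 ->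
  pw K node U x = (U i).[x].
Proof.
move=> iK xi; rewrite /pw (bigD1 (Ordinal iK))//= xi big1 ?addr0// => j ji.
case: ifPn => // /andP[jx xj]; exfalso; move/eqP: ji; apply; apply/val_inj => /=.
have [ix xi'] := andP xi; have jK := ltn_ord j.
apply/eqP; rewrite eqn_leq; apply/andP; split; rewrite leqNgt; apply/negP => ij.
- by have := le_trans (node_le ij (ltnW jK)) jx; rewrite leNgt xi'.
- by have := le_trans (node_le ij (ltnW iK)) ix; rewrite leNgt xj.
Qed.

Lemma measurable_horner (p : {poly R}) : measurable_fun setT (fun x => p.[x]).
Proof. by apply: continuous_measurable_fun; exact: continuous_horner. Qed.

(** No order between [x] and [y] is assumed, so that a bound can be chosen for every index [i], also
    for [i >= K] where the nodes need not increase. *)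
Lemma horner_bounded (p : {poly R}) x y :
  exists M, forall z, x <= z <= y -> `|p.[z]| <= M.
Proof.
have [xy|yx] := leP x y; last first.
  by exists 0 => z /andP[xz zy]; move: (le_trans xz zy); rewrite leNgt yx.
have cp : {within `[x, y], continuous (fun z => `|p.[z]|)}.
  apply: continuous_subspaceT => z.
  exact: (continuous_comp (@continuous_horner _ p z) (@norm_continuous _ _ _)).
have [c _ H] := EVT_max xy cp.
by exists `|p.[c]| => z zxy; apply: H; rewrite in_itv.
Qed.

Lemma bounded_supp_pw (U : nat -> {poly R}) : exists M, bounded_supp a b M (pw K node U).
Proof.
have /choice[M HM] : forall i : nat, exists M, forall z, node i <= z <= node i.+1 -> `|(U i).[z]| <= M.
  by move=> i; exact: horner_bounded.
(* Absolute values, because a cell not containing the point contributes 0 and its term must still be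
   an upper bound. *)
exists (\sum_(i < K) `|M i|); split.
- apply: measurable_sum => i.
  apply: measurable_fun_ifT => //.
  + apply: measurable_and; first exact: measurable_fun_ler.
    exact: measurable_fun_ltr.
  + exact: measurable_horner.
- move=> x; apply: (le_trans (ler_norm_sum _ _ _)); apply: ler_sum => i _.
  case: ifPn => [/andP[ix xi]|_]; last by rewrite normr0.
  by apply: le_trans (HM i x _) (ler_norm _); rewrite ix ltW.
- move=> x; rewrite in_itv/= => xab; rewrite /pw big1// => i _.
  case: ifPn => // /andP[ix xi]; move/negP: xab; case; apply/andP; split.
    exact: le_trans (node_ge_a (ltnW (ltn_ord i))) ix.
  exact: le_trans (ltW xi) (node_le_b (ltn_ord i)).
Qed.

Lemma L2norm_pw (U : nat -> {poly R}) : L2norm a b (pw K node U) =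
  Num.sqrt (\sum_(i < K) Rint `[node i, node i.+1] (fun x => (U i).[x] ^+ 2)).
Proof.
have [M bM] := bounded_supp_pw U; have [mp pM p0] := bM.
have b2 : bounded_supp a b (M ^+ 2) (fun x => pw K node U x ^+ 2).
  split; first exact: measurable_funX.
  - by move=> x; rewrite normrX lerXn2r ?nnegrE// (le_trans _ (pM x)).
  - by move=> x /p0 ->; rewrite expr0n.
rewrite /L2norm; congr Num.sqrt; rewrite Rint_mesh; last first.
  by apply: integrableS (bounded_supp_integrable b2).
apply: eq_bigr => i _; apply: Rint_itv_eq; last by apply: measurable_funTS; case: b2.
by move=> x; rewrite in_itv/= => xi; rewrite (pw_cell U (ltn_ord i)).
Qed.

Lemma bounded_supp_mul_riesz g M p : 0 < g < 1 -> bounded_supp a b M p ->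
  exists N, bounded_supp a b N (fun x => p x * riesz g p x).
Proof.
move=> g01 bp; have bq := bounded_supp_pos bp; have br := bounded_supp_neg bp.
have := bounded_suppB (bounded_suppM_riesz g01 bp bq (funrpos_ge0 p))
  (bounded_suppM_riesz g01 bp br (funrneg_ge0 p)).
set F := (X in bounded_supp _ _ _ X) => H; eexists.
rewrite (_ : (fun x => p x * riesz g p x) = F); first exact: H.
apply/funext => x; rewrite /F.
have [xab|xab] := boolP (x \in `[a, b]); last by have [_ _ ->//] := bp; rewrite !mul0r subrr.
by rewrite -mulrBr -(rieszB g01 xab bq br); congr (_ * riesz g _ x); rewrite -[LHS]funrposBneg.
Qed.

(** Splitting the line integral at [x] recovers the two one-sided integrals, with
    [g = alpha - 1]. *)
Lemma frac_op_riesz alpha M p x : 1 < alpha < 2 -> bounded_supp a b M p -> x \in `[a, b] ->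
  frac_op alpha a b p x =
  (2 * cos ((2 - alpha) * pi / 2) * Gamma (2 - alpha))^-1 * riesz (alpha - 1) p x.
Proof.
move=> /andP[al1 al2] bp xab; rewrite /frac_op; congr (_ * _).
rewrite (_ : 1 - alpha = - (alpha - 1)); last by rewrite opprB.
have g01 : 0 < alpha - 1 < 1 by rewrite subr_gt0 al1 ltrBlDr.
have irp := riesz_integrable g01 xab bp.
have [ax xb] : a <= x /\ x <= b by move: xab; rewrite in_itv/= => /andP.
rewrite /riesz (@Rintegral_supp _ a b); last first.
  by have [_ _ p0] := bp; move=> s /p0 ->; rewrite mulr0.
rewrite -/(Rint _ _) (Rint_itv_cat ax xb); last exact: integrableS irp.
apply: (f_equal2 (fun u v : R => u + v)).
  apply: eq_Rintegral => s; rewrite inE/= in_itv/= => /andP[_ sx].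
  by rewrite ger0_norm// subr_ge0.
apply: eq_Rintegral => s; rewrite inE/= in_itv/= => /andP[xs _].
by rewrite distrC ger0_norm// subr_ge0.
Qed.

Lemma frac_op_form_ge0 alpha (P : nat -> {poly R}) : 1 < alpha < 2 ->
  0 <= \sum_(i < K) Rint `[node i, node i.+1]
         (fun x => frac_op alpha a b (pw K node P) x * (P i).[x]).
Proof.
move=> al; have [al1 al2] := andP al.
have g01 : 0 < alpha - 1 < 1 by rewrite subr_gt0 al1 ltrBlDr.
have [M bp] := bounded_supp_pw P.
set p := pw K node P in bp *.
have [N bpr] := bounded_supp_mul_riesz g01 bp.
set c := (2 * cos ((2 - alpha) * pi / 2) * Gamma (2 - alpha))^-1.
(* For [1 < alpha < 2] the argument of the cosine lies between 0 and [pi / 2], and [Gamma] is the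
   integral of a nonnegative function. *)
have c0 : 0 <= c.
  rewrite invr_ge0 !mulr_ge0//.
    apply: cos_ge0_pihalf.
    have := pi_gt0 R; set q : R := pi => q0; apply/andP; split; nra.
  by apply: Rintegral_ge0 => t _; rewrite mulr_ge0 ?powR_ge0 ?expR_ge0.
have ir : mu.-integrable `[a, b] (EFin \o (fun x => p x * riesz (alpha - 1) p x)).
  exact: integrableS (bounded_supp_integrable bpr).
have mcpr : measurable_fun setT (fun x => c * (p x * riesz (alpha - 1) p x)).
  by apply: measurable_funM => //; case: bpr.
suff -> : \sum_(i < K) Rint `[node i, node i.+1] (fun x => frac_op alpha a b p x * (P i).[x]) =
    c * Rint `[a, b] (fun x => p x * riesz (alpha - 1) p x).
  rewrite mulr_ge0// /Rint -Rintegral_supp; first exact: riesz_form_ge0 bp.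
  by case: bpr.
rewrite Rint_mesh// mulr_sumr; apply: eq_bigr => i _.
have iab : `[node i, node i.+1] `<=` `[a, b].
  apply: subset_itv; rewrite bnd_simp; first exact/node_ge_a/ltnW.
  exact: node_le_b.
rewrite {2}/Rint -RintegralZl//; last exact: integrableS ir.
apply/esym; apply: Rint_itv_eq; last exact: measurable_funTS.
move=> x xi; have xab : x \in `[a, b].
  suff : `[a, b]%classic x by [].
  by apply: iab; move: xi; rewrite /= !in_itv/= => /andP[-> /ltW ->].
have pE : p x = (P i).[x] by apply: pw_cell => //; move: xi; rewrite in_itv.
by rewrite (frac_op_riesz al bp xab) -/c pE -[RHS]mulrA (mulrC (riesz _ _ _)).
Qed.

End mesh.

(** * Convective and diffusive fluxes on one cell and at one node *)

Section flux.
Context {R : realType}.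
Notation mu := (@lebesgue_measure R).
Implicit Types (x y z B u v : R) (p q : {poly R}) (f F : R -> R).

Lemma is_derive_horner p z : is_derive z 1 (horner p) (p^`()).[z].
Proof.
by apply: DeriveDef; [exact: derivable_horner|rewrite derivE derive1E].
Qed.

Lemma Rint_FTC2 f F x y : x < y -> continuous f ->
  (forall z, x <= z <= y -> is_derive z 1 F (f z)) ->
  Rint `[x, y] f = F y - F x.
Proof.
move=> xy cf dF; rewrite /Rint /Rintegral -[RHS]/(fine (F y - F x)%:E); congr fine.
by apply: integral_itv_FTC2 => //; exact: continuous_subspaceT.
Qed.

Lemma Rint_deriv p x y : x < y -> Rint `[x, y] (fun z => (p^`()).[z]) = p.[y] - p.[x].
Proof.
move=> xy; apply: Rint_FTC2 => //; first exact: continuous_horner.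
Qed.

Lemma continuous_hornerM p q : continuous (fun z : R => p.[z] * q.[z]).
Proof. by move=> z; apply: continuousM; exact: continuous_horner. Qed.

Lemma Rint_horner_parts p q x y : x < y ->
  Rint `[x, y] (fun z => p.[z] * (q^`()).[z]) + Rint `[x, y] (fun z => q.[z] * (p^`()).[z]) =
  p.[y] * q.[y] - p.[x] * q.[x].
Proof.
move=> xy; rewrite -!hornerM -Rint_deriv// /Rint -RintegralD//; last 2 first.
- exact/continuous_integrable_itv/continuous_hornerM.
- exact/continuous_integrable_itv/continuous_hornerM.
by apply: eq_Rintegral => z _; rewrite derivM hornerD !hornerM mulrC addrC (mulrC q.[z]).
Qed.

Lemma monotone_flux_continuous f (fh : R -> R -> R) : monotone_flux f fh -> continuous f.
Proof.
move=> [[L HL] [cons _]] z.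
apply/cvgrPdist_le => /= e e0.
(* The Lipschitz constant comes without a sign; [|L| + 1] is a positive replacement. Both arguments
   of [fh s s] move with [s], hence the factor 2 below. *)
have L0 : 0 < `|L| + 1 by rewrite ltr_wpDl.
near=> t; rewrite -!cons (le_trans (HL _ _ _ _))//.
have zt : `|z - t| <= e / (2 * (`|L| + 1)).
  near: t; apply/nbhs_normP; exists (e / (2 * (`|L| + 1))); first by rewrite /= divr_gt0// mulr_gt0.
  by move=> t /= /ltW.
have h1 : L <= `|L| := ler_norm L.
apply: (@le_trans _ _ ((`|L| + 1) * (`|z - t| + `|z - t|))).
  by rewrite ler_wpM2r ?addr_ge0// (le_trans h1)// lerDl.
rewrite -mulr2n mulrnAr -mulr_natl mulrCA mulrA.
by rewrite mulrC (mulrC _ 2) -ler_pdivlMr ?mulr_gt0.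
Unshelve. all: by end_near. Qed.

(** The base point is [- B], so [F 0] need not vanish; it cancels between the two ends of the mesh
    in [flux_sum_ge0]. *)
Lemma continuous_antiderivative f B : continuous f ->
  exists F, forall z, - B < z < B -> is_derive z 1 F (f z).
Proof.
move=> cf; exists (fun y => \int[mu]_(t in `[- B, y]) f t) => z /andP[Bz zB].
have fi := continuous_integrable_itv (- B) B cf.
by have [d1 d2] := continuous_FTC1_closed zB fi Bz (cf z); apply: DeriveDef; rewrite -?derive1E.
Qed.

(** With [u_h] as its own test function the convective volume term is the exact derivative of
    [F \o horner p], and only traces of [F] remain. *)
Lemma Rint_flux f F B p x y : x < y -> continuous f ->
  (forall z, - B < z < B -> is_derive z 1 F (f z)) ->
  (forall z, x <= z <= y -> - B < p.[z] < B) ->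
  Rint `[x, y] (fun z => f p.[z] * (p^`()).[z]) = F p.[y] - F p.[x].
Proof.
move=> xy cf dF pB; apply: (@Rint_FTC2 _ (F \o horner p)) => //.
  move=> z; apply: continuousM; last exact: continuous_horner.
  exact: (continuous_comp (@continuous_horner _ p z) (cf _)).
move=> z /pB /dF dFz; exact: (is_derive1_comp dFz (is_derive_horner p z)).
Qed.

(** The E-flux property. The mean value theorem gives [F v - F u = f c * (v - u)] with [c] between
    [u] and [v]. For [u < v], [fh u v <= fh c v <= fh c c = f c]; for [v < u] both inequalities
    reverse. *)
Lemma monotone_flux_node f fh F B u v : monotone_flux f fh ->
  (forall z, - B < z < B -> is_derive z 1 F (f z)) ->
  - B < u < B -> - B < v < B ->
  0 <= fh u v * (u - v) - F u + F v.
Proof.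
move=> [_ [cons [inc dec]]] dF.
have mv x y : x < y -> - B < x < B -> - B < y < B ->
    exists2 c, x <= c <= y & F y - F x = f c * (y - x).
  move=> xy /andP[Bx _] /andP[_ yB].
  have dF' z : x <= z <= y -> is_derive z 1 F (f z).
    by move=> /andP[xz zy]; apply: dF; rewrite (lt_le_trans Bx xz) (le_lt_trans zy yB).
  have [||c] := @MVT _ F f x y xy.
  - by move=> z; rewrite in_itv/= => /andP[/ltW xz /ltW zy]; apply: dF'; rewrite xz.
  - apply: continuous_in_subspaceT => z; rewrite inE/= in_itv/= => /dF' H.
    exact: is_derive_continuous H.
  - by rewrite in_itv/= => /andP[/ltW xc /ltW cy] ->; exists c; rewrite ?xc.
move=> uB vB; have [uv|vu|->] := ltgtP u v; last by rewrite subrr mulr0 add0r addrC subrr.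
- have [c /andP[uc cv] E] := mv _ _ uv uB vB.
  have h : fh u v <= f c by rewrite -cons (le_trans (inc _ _ _ uc))// dec.
  have : 0 <= (f c - fh u v) * (v - u) by rewrite mulr_ge0 ?subr_ge0// ltW.
  by move: E; lra.
- have [c /andP[vc cu] E] := mv _ _ vu vB uB.
  have h : f c <= fh u v by rewrite -cons (le_trans (inc _ _ _ cu))// dec.
  have : 0 <= (fh u v - f c) * (u - v) by rewrite mulr_ge0 ?subr_ge0// ltW.
  by move: E; lra.
Qed.

End flux.

(** * Energy dissipation at a fixed time *)

Section energy.
Context {R : realType}.
Notation mu := (@lebesgue_measure R).
Variables (K : nat) (node : nat -> R) (a b : R).
Hypothesis mesh : mesh_ok K node a b.

Let K_gt0 : (0 < K)%N. Proof. by case: mesh. Qed.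
Let node_lt i : (i < K)%N -> node i < node i.+1.
Proof. by case: mesh => _ [_ [_]]; exact. Qed.

Variables U P Q : nat -> {poly R}.

Lemma flux_sum_ge0 (f F : R -> R) (fh : R -> R -> R) (B : R) : monotone_flux f fh -> 0 < B ->
  (forall z, - B < z < B -> is_derive z 1 F (f z)) ->
  (forall i z, (i < K)%N -> node i <= z <= node i.+1 -> - B < (U i).[z] < B) ->
  0 <= \sum_(i < K) (fflux fh K node U i.+1 * (U i).[node i.+1]
                      - fflux fh K node U i * (U i).[node i]
                      - (F (U i).[node i.+1] - F (U i).[node i])).
Proof.
move=> mf B0 dF UB.
(* Left and right traces at node [j], with the exterior value 0 at the two ends. Under this
   convention the boundary fluxes are no exception: every flux is [fh (L j) (D j)]. The bound
   [0 < B] keeps the exterior value in the domain of [F]. *)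
pose L j : R := if j == 0%N then 0 else (U j.-1).[node j].
pose D j : R := if j == K then 0 else (U j).[node j].
have zB : - B < 0 < B by rewrite oppr_lt0 B0.
have LB j : (j <= K)%N -> - B < L j < B.
  rewrite /L; case: j => [|j] jK //=; apply: UB => //.
  by rewrite lexx ltW// node_lt.
have DB j : (j <= K)%N -> - B < D j < B.
  rewrite /D; case: eqVneq => // jK jK'; have lt_jK : (j < K)%N by rewrite ltn_neqAle jK.
  by apply: UB => //; rewrite lexx ltW// node_lt.
have fE j : (j <= K)%N -> fflux fh K node U j = fh (L j) (D j).
  rewrite /fflux /L /D; case: j => [|j] jK /=; first by rewrite eq_sym gtn_eqF.
  by case: ifP.
(* With [A j] and [C j] the left and right contributions at node [j], the sum
   over cells of [A i.+1 - C i] regroups by nodes: the outer values [L 0] and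
   [D K] vanish, so both boundary remainders equal [- F 0]. *)
pose A j := fh (L j) (D j) * L j - F (L j).
pose C j := fh (L j) (D j) * D j - F (D j).
have -> : \sum_(i < K) (fflux fh K node U i.+1 * (U i).[node i.+1]
    - fflux fh K node U i * (U i).[node i] - (F (U i).[node i.+1] - F (U i).[node i])) =
    \sum_(i < K.+1) (A i - C i).
  have SA : \sum_(i < K.+1) A i = A 0%N + \sum_(i < K) A i.+1.
    by rewrite big_ord_recl; congr (_ + _); apply: eq_bigr.
  have SC : \sum_(i < K.+1) C i = \sum_(i < K) C i + C K by rewrite big_ord_recr.
  rewrite [RHS]sumrB SA SC.
  have -> : A 0%N = - F 0 by rewrite /A /L/= mulr0 sub0r.
  have -> : C K = - F 0 by rewrite /C /D eqxx mulr0 sub0r.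
  have cancel (x y z : R) : x + y - (z + x) = y - z by ring.
  rewrite cancel.
  rewrite -sumrB; apply: eq_bigr => i _; have iK := ltn_ord i.
  rewrite !fE ?(ltnW iK)// /A /C.
  have -> : L i.+1 = (U i).[node i.+1] by [].
  have -> : D i = (U i).[node i] by rewrite /D ltn_eqF.
  by ring.
apply: sumr_ge0 => i _; have iK : (i <= K)%N by rewrite -ltnS.
have := monotone_flux_node mf dF (LB _ iK) (DB _ iK).
by rewrite /A /C; lra.
Qed.

(** The summand collects the boundary terms of the equation for [u_h], those of the equation for
    [p_h], and those of the integration by parts that links the two volume terms. *)
Lemma diffusion_flux_sum_ge0 beta h : 0 <= beta -> 0 <= h ->
  0 <= \sum_(i < K) (- (qhat K node beta h U Q i.+1 * (U i).[node i.+1])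
                      + qhat K node beta h U Q i * (U i).[node i]
                      - (uhat K node U i.+1 * (Q i).[node i.+1] - uhat K node U i * (Q i).[node i])
                      + ((U i).[node i.+1] * (Q i).[node i.+1] - (U i).[node i] * (Q i).[node i])).
Proof.
move=> beta0 h0.
(* The alternating fluxes make the interior contributions telescope; only the
   penalty at the right end survives. *)
pose D j : R := if (j == 0%N) || (j == K) then 0 else (U j.-1).[node j] * (Q j).[node j].
pose E (i : nat) : R := if i.+1 == K then beta / h * (U i).[node i.+1] ^+ 2 else 0.
rewrite (eq_bigr (fun i : 'I_K => D i - D i.+1 + E i)); last first.
  move=> i _; have iK := ltn_ord i.
  rewrite /qhat /uhat /D /E /= (ltn_eqF iK).
  by case: (eqVneq i.+1 K) => iK1; case: (eqVneq (i : nat) 0%N) => i0 /=; ring.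
rewrite big_split/= addr_ge0//; last first.
  apply: sumr_ge0 => i _; rewrite /E; case: ifP => // _.
  by rewrite mulr_ge0 ?sqr_ge0 ?divr_ge0.
suff -> : \sum_(i < K) (D i - D i.+1) = 0 by [].
have -> : \sum_(i < K) (D i - D i.+1) = - (\sum_(0 <= i < K) (D i.+1 - D i)).
  by rewrite big_mkord -sumrN; apply: eq_bigr => i _; rewrite opprB.
by rewrite telescope_sumr// /D !eqxx orbT subrr oppr0.
Qed.

Lemma cells_bounded : exists2 B, 0 < B &
  forall i z, (i < K)%N -> node i <= z <= node i.+1 -> - B < (U i).[z] < B.
Proof.
have /choice[M HM] : forall i : nat, exists M, forall z, node i <= z <= node i.+1 -> `|(U i).[z]| <= M.
  by move=> i; exact: horner_bounded.
have S0 (I : pred 'I_K) : 0 <= \sum_(i < K | I i) `|M i| by apply: sumr_ge0.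
(* The added 1 makes the bound strict and positive. *)
exists (\sum_(i < K) `|M i| + 1) => [|i z iK zi]; first by rewrite ltr_wpDl.
rewrite -ltr_norml (le_lt_trans (HM i z zi))// (le_lt_trans (ler_norm _))//.
by rewrite (bigD1 (Ordinal iK))//= -addrA ltrDl ltr_wpDl.
Qed.

(** A statement about one instant, with an arbitrary [W] for the time derivative. Minus the
    left-hand side equals, cell by cell, the convective term plus the fractional term plus [se]
    times the diffusive term, and each of the three has a nonnegative sum. *)
Lemma energy_dissipation alpha se beta f fh (W : nat -> R -> R) :
  let h := meshsize K node in
  1 < alpha < 2 -> 0 <= se -> 0 <= beta -> monotone_flux f fh ->
  (forall i, (i < K)%N -> let xl := node i in let xr := node i.+1 in
     Rint `[xl, xr] (fun x => W i x * (U i).[x])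
     + ((fflux fh K node U i.+1 - se * qhat K node beta h U Q i.+1) * (U i).[xr]
        - (fflux fh K node U i - se * qhat K node beta h U Q i) * (U i).[xl])
     - Rint `[xl, xr] (fun x => (f (U i).[x] - se * (Q i).[x]) * ((U i)^`()).[x]) = 0) ->
  (forall i, (i < K)%N -> let xl := node i in let xr := node i.+1 in
     Rint `[xl, xr] (fun x => (Q i).[x] * (P i).[x])
     - Rint `[xl, xr] (fun x => frac_op alpha a b (pw K node P) x * (P i).[x]) = 0) ->
  (forall i, (i < K)%N -> let xl := node i in let xr := node i.+1 in
     Rint `[xl, xr] (fun x => (P i).[x] * (Q i).[x])
     - se * (uhat K node U i.+1 * (Q i).[xr] - uhat K node U i * (Q i).[xl])
     + se * Rint `[xl, xr] (fun x => (U i).[x] * ((Q i)^`()).[x]) = 0) ->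
  \sum_(i < K) Rint `[node i, node i.+1] (fun x => W i x * (U i).[x]) <= 0.
Proof.
move=> h al se0 beta0 mf e1 e2 e3.
have cf := monotone_flux_continuous mf.
have h0 : 0 <= h by apply: bigmax_ge_id.
have [B B0 UB] := cells_bounded.
have [F dF] := continuous_antiderivative B cf.
have conv := flux_sum_ge0 mf B0 dF UB.
have diff := diffusion_flux_sum_ge0 beta0 h0.
have frac := frac_op_form_ge0 mesh P al.
rewrite -oppr_ge0 -sumrN.
have := addr_ge0 (addr_ge0 conv frac) (mulr_ge0 se0 diff).
rewrite mulr_sumr -!big_split/= => /le_trans; apply; rewrite le_eqVlt; apply/orP; left; apply/eqP.
apply: eq_bigr => i _; have iK := ltn_ord i.
have := e1 i iK; have := e2 i iK; have := e3 i iK => /=.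
have fl := Rint_flux (node_lt iK) cf dF (fun z => UB i z iK).
have parts := Rint_horner_parts (Q i) (U i) (node_lt iK).
have -> : Rint `[node i, node i.+1] (fun x => (f (U i).[x] - se * (Q i).[x]) * ((U i)^`()).[x]) =
    F (U i).[node i.+1] - F (U i).[node i]
    - se * Rint `[node i, node i.+1] (fun x => (Q i).[x] * ((U i)^`()).[x]).
  have cQ : continuous (fun x => (Q i).[x] * ((U i)^`()).[x]) by exact: continuous_hornerM.
  rewrite -fl /Rint -RintegralZl//; last exact: continuous_integrable_itv.
  rewrite -RintegralB//; last 2 first.
  - apply: continuous_integrable_itv => z; apply: continuousM; last exact: continuous_horner.
    exact: (continuous_comp (@continuous_horner _ (U i) z) (cf _)).
  - by apply: continuous_integrable_itv => z; apply: cvgM; [exact: cvg_cst|exact: cQ].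
  by apply: eq_Rintegral => z _; rewrite mulrBl mulrA.
have -> : Rint `[node i, node i.+1] (fun x => (P i).[x] * (Q i).[x]) =
    Rint `[node i, node i.+1] (fun x => (Q i).[x] * (P i).[x]).
  by apply: eq_Rintegral => z _; rewrite mulrC.
set X := Rint _ (fun x => W i x * _); set Fr := Rint _ (fun x => frac_op _ _ _ _ _ * _).
set PQ := Rint _ (fun x => (Q i).[x] * (P i).[x]).
move: parts; set J1 := Rint _ _; set J2 := Rint _ _.
rewrite -/J1 -/J2.
move: X Fr PQ J1 J2 (F (U i).[node i.+1]) (F (U i).[node i]) => {e1 e2 e3} X Fr PQ J1 J2 F1 F0.
move: (qhat K node beta h U Q i) (qhat K node beta h U Q i.+1) (uhat K node U i)
  (uhat K node U i.+1) (fflux fh K node U i) (fflux fh K node U i.+1) => q0 q1 w0 w1 f0 f1.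
move: ((U i).[node i]) ((U i).[node i.+1]) ((Q i).[node i]) ((Q i).[node i.+1]).
move=> u0 u1 v0 v1 parts e3 e2 e1.
(* The second equation replaces the fractional term by [PQ], the third writes [PQ] through traces
   and [J2], and integration by parts does the same for [J1]; the volume term [J2] then cancels. *)
have -> : Fr = PQ by apply/esym/eqP; rewrite -subr_eq0 e2.
have -> : PQ = se * (w1 * v1 - w0 * v0) - se * J2.
  by apply/eqP; rewrite eq_sym -subr_eq0 -oppr_eq0 -e3; apply/eqP; ring.
have JE : J1 = v1 * u1 - v0 * u0 - J2 by rewrite -parts addrK.
have -> : X = F1 - F0 - se * J1 - ((f1 - se * q1) * u1 - (f0 - se * q0) * u0).
  by apply/eqP; rewrite -subr_eq0 -e1; apply/eqP; ring.
by rewrite JE; ring.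
Qed.

End energy.

(** * Evolution of the energy in time and the initial projection *)

Section evolution.
Context {R : realType}.
Notation mu := (@lebesgue_measure R).
Implicit Types (x y t : R).

Lemma cvg_sum_fun (T I : Type) (F : set_system T) (FF : Filter F) (r : seq I)
    (h : I -> T -> R) (l : I -> R) :
  (forall i, h i s @[s --> F] --> l i) ->
  \sum_(i <- r) h i s @[s --> F] --> \sum_(i <- r) l i.
Proof.
by move=> H; apply: cvg_big => // z; exact: add_continuous.
Qed.

(** Separates time from space: the coefficients carry the time dependence and the moments do not, so
    derivatives and limits in time act on a finite sum. *)
Lemma Rint_hornerM_coef k (p q : {poly R}) x y :
  (size p <= k)%N -> (size q <= k)%N ->
  Rint `[x, y] (fun z => p.[z] * q.[z]) =
  \sum_(j < k) \sum_(l < k) p`_j * q`_l * Rint `[x, y] (fun z => z ^+ (j + l)).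
Proof.
move=> sp sq.
have cX n : continuous (fun z : R => z ^+ n) by move=> z; exact: exprn_continuous.
have Rsum (I : Type) (r : seq I) (h : I -> R -> R) : (forall i, continuous (h i)) ->
    Rint `[x, y] (fun z => \sum_(i <- r) h i z) = \sum_(i <- r) Rint `[x, y] (h i).
  move=> ch; elim: r => [|i r IH].
    rewrite big_nil /Rint; under eq_Rintegral do rewrite big_nil.
    by rewrite Rintegral_cst// mul0r.
  rewrite big_cons -IH /Rint -RintegralD//.
  - by apply: eq_Rintegral => z _; rewrite big_cons.
  - exact: continuous_integrable_itv.
  - apply: continuous_integrable_itv => z.
    by apply: cvg_sum_fun => j; exact: ch.
have cc j l : continuous (fun z : R => p`_j * q`_l * z ^+ (j + l)).
  by move=> z; apply: cvgM; [exact: cvg_cst|exact: cX].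
transitivity (Rint `[x, y] (fun z => \sum_(j < k) \sum_(l < k) p`_j * q`_l * z ^+ (j + l))).
  apply: eq_Rintegral => z _; rewrite (horner_coef_wide _ sp) (horner_coef_wide _ sq).
  rewrite mulr_suml; apply: eq_bigr => j _; rewrite mulr_sumr; apply: eq_bigr => l _.
  by rewrite exprD; ring.
rewrite Rsum; last by move=> j z; apply: cvg_sum_fun => l; exact: cc.
apply: eq_bigr => j _; rewrite Rsum; last by move=> l; exact: cc.
apply: eq_bigr => l _; rewrite /Rint RintegralZl//.
by apply: continuous_integrable_itv; exact: cX.
Qed.

Lemma is_derive_fun_sum n (h : 'I_n -> R -> R) t (dh : 'I_n -> R) :
  (forall i, is_derive t 1 (h i) (dh i)) ->
  is_derive t 1 (fun s => \sum_(i < n) h i s) (\sum_(i < n) dh i).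
Proof.
move=> H; rewrite (_ : (fun s => _) = \sum_(i < n) h i); first exact: is_derive_sum.
by apply/funext => s; rewrite fct_sumE.
Qed.

Section cell.
Variables (k : nat) (V : R -> {poly R}).
Hypothesis sV : forall t, (size (V t) <= k)%N.

Lemma dt_horner t x : (forall j, derivable (fun s => (V s)`_j) t 1) ->
  derive1 (fun s => (V s).[x]) t = (\poly_(j < k) derive1 (fun s => (V s)`_j) t).[x].
Proof.
move=> dV; rewrite horner_poly.
have H : is_derive t 1 (fun s => \sum_(j < k) (V s)`_j * x ^+ j)
    (\sum_(j < k) derive1 (fun s => (V s)`_j) t * x ^+ j).
  apply: is_derive_fun_sum => j.
  have d1 : is_derive t 1 (fun s => (V s)`_j) (derive1 (fun s => (V s)`_j) t).
    by apply: DeriveDef; rewrite ?derive1E.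
  have := is_deriveM d1 (is_derive_cst (x ^+ j) t 1).
  move=> H; apply: is_derive_eq H _.
  by rewrite scaler0 add0r /GRing.scale/= mulrC.
rewrite derive1E -[RHS](@derive_val _ _ _ _ _ _ _ H); congr ('D_1 _ t).
by apply/funext => s; rewrite (horner_coef_wide _ (sV s)).
Qed.

Lemma is_derive_cell_energy t x y : (forall j, derivable (fun s => (V s)`_j) t 1) ->
  is_derive t 1 (fun s => Rint `[x, y] (fun z => (V s).[z] ^+ 2))
    (2 * Rint `[x, y] (fun z => derive1 (fun s => (V s).[z]) t * (V t).[z])).
Proof.
move=> dV; pose m n := Rint `[x, y] (fun z => z ^+ n).
pose c (j : nat) s := (V s)`_j.
have dc j : is_derive t 1 (c j) (derive1 (c j) t).
  by apply: DeriveDef; rewrite ?derive1E//; exact: dV.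
have -> : (fun s => Rint `[x, y] (fun z => (V s).[z] ^+ 2)) =
    (fun s => \sum_(j < k) \sum_(l < k) c j s * c l s * m (j + l)%N).
  by apply/funext => s; rewrite -(Rint_hornerM_coef _ _ (sV s) (sV s)).
have -> : Rint `[x, y] (fun z => derive1 (fun s => (V s).[z]) t * (V t).[z]) =
    \sum_(j < k) \sum_(l < k) derive1 (c j) t * c l t * m (j + l)%N.
  under [X in Rint _ X]eq_fun do rewrite dt_horner//.
  rewrite (Rint_hornerM_coef _ _ (size_poly _ _) (sV t)).
  by apply: eq_bigr => j _; apply: eq_bigr => l _; rewrite coef_poly ltn_ord.
have -> : 2 * (\sum_(j < k) \sum_(l < k) derive1 (c j) t * c l t * m (j + l)%N) =
    \sum_(j < k) \sum_(l < k) (derive1 (c j) t * c l t + c j t * derive1 (c l) t) * m (j + l)%N.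
  (* The moment depends on [j + l] only, so exchanging the indices in one of the two copies yields
     the second half of the product rule. *)
  rewrite mulr2n mulrDl mul1r {2}exchange_big/= -big_split/=; apply: eq_bigr => j _.
  rewrite -big_split/=; apply: eq_bigr => l _.
  by rewrite mulrDl (addnC l) (mulrC (c j t)).
apply: is_derive_fun_sum => j; apply: is_derive_fun_sum => l.
have := is_deriveM (is_deriveM (dc j) (dc l)) (is_derive_cst (m (j + l)%N) t 1).
rewrite scaler0 add0r /GRing.scale/= => H; apply: is_derive_eq H _.
by rewrite mulrC addrC (mulrC (c l t)).
Qed.

Lemma cvg_cell_energy x y : (forall j, (V s)`_j @[s --> 0^'+] --> (V 0)`_j) ->
  Rint `[x, y] (fun z => (V s).[z] ^+ 2) @[s --> 0^'+] -->
  Rint `[x, y] (fun z => (V 0).[z] ^+ 2).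
Proof.
move=> cV.
have E s : Rint `[x, y] (fun z => (V s).[z] ^+ 2) = \sum_(j < k) \sum_(l < k)
    (V s)`_j * (V s)`_l * Rint `[x, y] (fun z => z ^+ (j + l)).
  by rewrite -(Rint_hornerM_coef _ _ (sV s) (sV s)).
rewrite E (_ : (fun s => _) = (fun s => \sum_(j < k) \sum_(l < k)
    (V s)`_j * (V s)`_l * Rint `[x, y] (fun z => z ^+ (j + l)))); last exact/funext.
apply: cvg_sum_fun => j; apply: cvg_sum_fun => l.
by apply: cvgM; [apply: cvgM; exact: cV|exact: cvg_cst].
Qed.

End cell.

(** The derivative is known at positive times only; right continuity ties the energy to its initial
    value. *)
Lemma derivable_nonincreasing (E dE : R -> R) T : 0 < T ->
  (forall t, 0 < t -> is_derive t 1 E (dE t)) -> (forall t, 0 < t -> dE t <= 0) ->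
  E s @[s --> 0^'+] --> E 0 -> E T <= E 0.
Proof.
move=> T0 dEt dE0 E0.
apply: (@ler0_derive1_nincr _ E 0 T) => //; last exact: ltW.
- by move=> t; rewrite in_itv/= => /andP[t0 _]; case: (dEt _ t0).
- move=> t; rewrite in_itv/= => /andP[t0 _]; rewrite derive1E.
  by case: (dEt _ t0) => _ ->; exact: dE0.
apply/continuous_within_itvP => //; split => //.
- by move=> t; rewrite in_itv/= => /andP[t0 _]; exact: is_derive_continuous (dEt _ t0).
- by apply: cvg_at_left_filter; exact: is_derive_continuous (dEt _ T0).
Qed.

Lemma Rint_projection_le (p : {poly R}) (u : R -> R) x y :
  measurable_fun `[x, y] u -> mu.-integrable `[x, y] (EFin \o (fun z => u z ^+ 2)) ->
  Rint `[x, y] (fun z => p.[z] * p.[z]) = Rint `[x, y] (fun z => u z * p.[z]) ->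
  Rint `[x, y] (fun z => p.[z] ^+ 2) <= Rint `[x, y] (fun z => u z ^+ 2).
Proof.
move=> meas_u iu pp.
have ip : mu.-integrable `[x, y] (EFin \o (fun z => p.[z] * p.[z])).
  exact/continuous_integrable_itv/continuous_hornerM.
(* Dominated by [u^2 + p^2], since [|u p| <= u^2 + p^2]. *)
have iup : mu.-integrable `[x, y] (EFin \o (fun z => u z * p.[z])).
  apply: (le_integrable _ _ _ (integrableD _ iu ip)) => //.
  - apply/measurable_EFinP; apply: measurable_funM => //.
    by apply: measurable_funTS; exact: measurable_horner.
  - move=> z _ /=; rewrite lee_fin.
    rewrite [leRHS]ger0_norm; last by rewrite addr_ge0 ?sqr_ge0// -expr2 sqr_ge0.
    rewrite ler_norml; apply/andP; split.
      by have := sqr_ge0 (u z + p.[z]); have := sqr_ge0 (u z); have := sqr_ge0 p.[z]; nra.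
    by have := sqr_ge0 (u z - p.[z]); have := sqr_ge0 (u z); have := sqr_ge0 p.[z]; nra.
have i2 : mu.-integrable `[x, y] (EFin \o (fun z => 2 * (u z * p.[z]))).
  exact: (integrableZl _ 2 iup).
(* [2 u p - p^2 <= u^2], and the projection identity turns the left-hand
   integral into that of [p^2]. *)
have H : Rint `[x, y] (fun z => 2 * (u z * p.[z]) - p.[z] * p.[z]) <= Rint `[x, y] (fun z => u z ^+ 2).
  apply: le_Rintegral => //; first exact: (integrableB _ i2 ip).
  by move=> z _; have := sqr_ge0 (u z - p.[z]); rewrite -subr_ge0; move: (u z) p.[z] => v w; nra.
move: H; rewrite {1}/Rint RintegralB// RintegralZl// -/(Rint _ _) -/(Rint _ _) -pp.
have -> : Rint `[x, y] (fun z => p.[z] * p.[z]) = Rint `[x, y] (fun z => p.[z] ^+ 2) by [].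
by move: (Rint _ _) (Rint _ _) => A B; lra.
Qed.

End evolution.

Theorem theorem4p2 (R : realType) (alpha eps beta a b : R) (K k : nat)
    (node : nat -> R) (f : R -> R) (fh : R -> R -> R) (u0 : R -> R)
    (U P Q : R -> nat -> {poly R}) :
  1 < alpha -> alpha < 2 -> 0 < eps -> 0 < beta ->
  mesh_ok K node a b ->
  lipschitz f -> monotone_flux f fh ->
  L2_on a b u0 ->
  LDG_solution alpha eps beta a b K k node f fh u0 U P Q ->
  forall T : R, 0 < T ->
    L2norm a b (pw K node (U T)) <= L2norm a b u0.
Proof.
move=> al1 al2 eps0 beta0 mesh _ mf [mu0 u0fin] [sz [reg [scheme init]]] T T0.
have al : 1 < alpha < 2 by rewrite al1.
pose E t := \sum_(i < K) Rint `[node i, node i.+1] (fun x => (U t i).[x] ^+ 2).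
pose dE t := \sum_(i < K) (2 * Rint `[node i, node i.+1] (fun x => dt_cell U i t x * (U t i).[x])).
have iu0 : (@lebesgue_measure R).-integrable `[a, b] (EFin \o (fun x => u0 x ^+ 2)).
  apply/integrableP; split; first exact/measurable_EFinP/measurable_funX.
  by under eq_integral do rewrite /= ger0_norm ?sqr_ge0//.
have ET : E T <= E 0.
  apply: (derivable_nonincreasing (dE := dE)) => //.
  - move=> t t0; apply: is_derive_fun_sum => i; have iK := ltn_ord i.
    apply: (@is_derive_cell_energy _ k.+1 (fun s => U s i)).
      by move=> s; have [] := sz s _ iK.
    by move=> j; have [+ _] := reg i j iK; apply.
  - move=> t t0; rewrite /dE -mulr_sumr pmulr_rle0//.
    apply: (energy_dissipation mesh (P := P t) (Q := Q t) (se := Num.sqrt eps) (f := f) (fh := fh)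
      (beta := beta) (alpha := alpha) (W := fun i => dt_cell U i t)) => //.
    + exact: ltW.
    + by move=> i iK; have [+ _] := scheme t t0 i iK; apply; have [] := sz t _ iK.
    + by move=> i iK; have [_ [+ _]] := scheme t t0 i iK; apply; have [_ []] := sz t _ iK.
    + by move=> i iK; have [_ [_ +]] := scheme t t0 i iK; apply; have [_ []] := sz t _ iK.
  - apply: cvg_sum_fun => i; have iK := ltn_ord i.
    apply: (@cvg_cell_energy _ k.+1 (fun s => U s i)).
      by move=> s; have [] := sz s _ iK.
    by move=> j; have [] := reg i j iK.
(* On each cell the initial condition is tested with [U 0 i] itself, which is the identity that
   [Rint_projection_le] asks for. *)
have E0 : E 0 <= Rint `[a, b] (fun x => u0 x ^+ 2).
  rewrite (Rint_mesh mesh)//; apply: ler_sum => i _; have iK := ltn_ord i.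
  have iab : `[node i, node i.+1] `<=` `[a, b].
    apply: subset_itv; rewrite bnd_simp; first exact: (node_ge_a mesh (ltnW iK)).
    exact: (node_le_b mesh iK).
  apply: Rint_projection_le.
  - exact: measurable_funS mu0.
  - exact: integrableS iu0.
  - by apply: init => //; have [] := sz 0 _ iK.
rewrite (L2norm_pw mesh); apply: ler_wsqrtr.
exact: le_trans ET E0.
Qed.
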